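(* Suppose that $c_A>0$, $c_D>0$, $m_D>0$, $c_\Sigma>0$ and $$c_A^2\geq c_Dc_\Sigma,\qquad c_\Sigma m_D>\Big(c_A-\sqrt{c_A^2-c_Dc_\Sigma}\Big)^2 .$$ Then for any $\lambda\in\Big[\frac{c_A-\sqrt{c_A^2-c_Dc_\Sigma}}{c_\Sigma},\sqrt{\frac{m_D}{c_\Sigma}}\Big)$, there is $\alpha\geq(m_D-c_\Sigma\lambda^2)/\lambda$ such that for all $P_1,P_2\in(0,\lambda I]$, $$d_T(M_t(P_1),M_t(P_2))\leq e^{-\alpha t}\,d_T(P_1,P_2)\qquad\text{for all } t\geq0.$$ In particular, there exists a unique solution $\bar P$ in $(0,\lambda I]$ of the algebraic Riccati equation $A'P+PA+D-P\Sigma P=0$, and for any $P\in(0,\lambda I]$, $$d_T(M_t(P),\bar P)\leq e^{-\alpha t}\,d_T(P,\bar P)\qquad\text{for all } t\geq0.$$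
   Context: $\mathbb{E}$ is a real or complex Hilbert space with inner product $\langle\cdot,\cdot\rangle$, $\operatorname{End}(\mathbb{E})$ its bounded linear operators, $A'$ the adjoint of $A$, $\operatorname{Sym}(\mathbb{E})$ the bounded self-adjoint operators, $\mathcal{P}$ the cone of positive semi-definite elements of $\operatorname{Sym}(\mathbb{E})$, and $\mathcal{P}_0$ its interior (the invertible elements of $\mathcal{P}$). $P\leq Q$ iff $Q-P\in\mathcal{P}$. For $X\in\operatorname{Sym}(\mathbb{E})$, $Y\in\mathcal{P}_0$, $M(X/Y)=\inf\{t\in\mathbb{R}:X\leq tY\}$; the Thompson metric on $\mathcal{P}_0$ is $d_T(X,Y)=\log\max\{M(X/Y),M(Y/X)\}$. $(0,\lambda I]=\{P\in\mathcal{P}_0:P\leq\lambda I\}$. $A\in\operatorname{End}(\mathbb{E})$ and $D,\Sigma\in\operatorname{Sym}(\mathbb{E})$ are constant, and $c_A,c_D,m_D,c_\Sigma\in\mathbb{R}$ are such that $A+A'\leq-2c_AI$, $m_DI\leq D\leq c_DI$, $\Sigma\geq-c_\Sigma I$. $M_t(P)$ is the value at time $t$ of the solution of $\dot P=A'P+PA+D-P\Sigma P$ with initial value $P$ at time $0$. *)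

(* Defs.v *)
From HB Require Import structures.
From mathcomp Require Import all_boot all_order all_algebra.
From mathcomp Require Import complex.
From mathcomp Require Import all_classical all_reals all_analysis.

Set Implicit Arguments.
Unset Strict Implicit.
Unset Printing Implicit Defensive.

Import Order.TTheory GRing.Theory Num.Theory.
Import numFieldNormedType.Exports.

Local Open Scope classical_set_scope.
Local Open Scope ring_scope.
Local Open Scope complex_scope.

Variant scalar_kind := RealScalars | ComplexScalars.

(* On [R[i]] the order is partial: [0 <= z] means that [z] is real and
   nonnegative; norms are nonnegative elements of [scalar_field R k]. *)
Definition scalar_field (R : realType) (k : scalar_kind) : numFieldType :=
  match k with
  | RealScalars => R : numFieldType
  | ComplexScalars => R[i] : numFieldType
  end.

Definition scalar_conj (R : realType) (k : scalar_kind) :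
    scalar_field R k -> scalar_field R k :=
  match k return scalar_field R k -> scalar_field R k with
  | RealScalars => fun z => z
  | ComplexScalars => fun z : R[i] => z^*
  end.

Definition scalar_of (R : realType) (k : scalar_kind) : R -> scalar_field R k :=
  match k return R -> scalar_field R k with
  | RealScalars => fun r => r
  | ComplexScalars => fun r => r%:C
  end.

(* The form is linear in its first argument and conjugate-linear in the
   second one. *)
Record hilbert_space (R : realType) (k : scalar_kind) := HilbertSpace {
  hilbert_sort :> completeNormedModType (scalar_field R k);
  inner : {dot hilbert_sort for @scalar_conj R k};
  norm_inner : forall x : hilbert_sort, `|x| ^+ 2 = inner x x
}.

Section Operators.
Context {R : realType} {k : scalar_kind} {E : hilbert_space R k}.
Implicit Types (A B P Q D S X Y : E -> E) (c t lambda : R).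

Definition bounded_op : set (E -> E) := [set A | linear A /\ continuous A].

(* A choice; the adjoint of a bounded operator exists and is unique. *)
Definition adjoint A : E -> E :=
  xget A [set B | bounded_op B /\
                  forall x y, inner E (A x) y = inner E x (B y)].

Definition scale_op c A : E -> E := scalar_of k c *: A.

Definition scalar_op c : E -> E := scale_op c idfun.

Definition sym_op : set (E -> E) :=
  [set P | bounded_op P /\ forall x y, inner E (P x) y = inner E x (P y)].

Definition psd_op : set (E -> E) :=
  [set P | sym_op P /\ forall x, 0 <= inner E (P x) x].

Definition le_op P Q : Prop := psd_op (Q - P).

(* The operator norm of [A] is at most [c] (for [0 <= c]). *)
Definition opnorm_le A c : Prop :=
  forall x, `|A x| <= scalar_of k c * `|x|.

(* The interior of [psd_op] relative to [sym_op] for the operator norm. *)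
Definition pos_op : set (E -> E) :=
  [set P | sym_op P /\ exists2 e : R, 0 < e &
     forall Q, sym_op Q -> opnorm_le (Q - P) e -> psd_op Q].

Definition pos_op_upto lambda : set (E -> E) :=
  [set P | pos_op P /\ le_op P (scalar_op lambda)].

Definition thompson_M X Y : R := inf [set t | le_op X (scale_op t Y)].

Definition thompson_dist X Y : R :=
  ln (Num.max (thompson_M X Y) (thompson_M Y X)).

Definition riccati_rhs A D S P : E -> E :=
  (adjoint A \o P) + (P \o A) + D - (P \o S \o P).

(* The derivative is taken in operator norm and within [J], hence one-sided at
   the endpoints of an interval [J]. *)
Definition riccati_solution A D S (J : set R) P (X : R -> E -> E) : Prop :=
  X 0 = P /\
  forall t, J t -> sym_op (X t) /\
    forall e : R, 0 < e -> \forall s \near t, J s ->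
      opnorm_le (X s - X t - scale_op (s - t) (riccati_rhs A D S (X t)))
                (e * `|s - t|).

(* The value at time [t] of the solution that starts from [P] (unique, as the
   vector field is locally Lipschitz); [P] if no solution exists up to [t]. *)
Definition riccati_flow A D S t P : E -> E :=
  xget P [set Y | exists2 X, riccati_solution A D S `[0, t] P X & X t = Y].

End Operators.

(* Main.v *)
Require Import Defs.
From HB Require Import structures.
From mathcomp Require Import all_boot all_order all_algebra.
From mathcomp Require Import complex ring lra.
From mathcomp Require Import all_classical all_reals all_analysis.

Set Implicit Arguments.
Unset Strict Implicit.
Unset Printing Implicit Defensive.

Import Order.TTheory GRing.Theory Num.Theory.
Import numFieldNormedType.Exports.

Local Open Scope classical_set_scope.
Local Open Scope ring_scope.

(** All inequalities between operators are read off quadratic forms. The engine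
    of the proof is the order preservation of the Riccati equation
    ([comparison]): if [Y1] is a subsolution, [Y2] a supersolution and
    [Y1(0) <= Y2(0)], then [Y1 <= Y2] at all later times. The difference
    [Z = Y2 - Y1] satisfies [Z' = C^* Z + Z C + G] with [G >= 0], and such a
    curve cannot leave the positive cone ([form_psd_stays]). Every qualitative
    fact about the flow is an instance of it:

    - two solutions with the same initial value are sub- and supersolutions of
      each other, hence equal;
    - [lambda I] is a supersolution because [lambda] lies between the roots of
      [cS X^2 - 2 cA X + cD], and [d I] is a subsolution for small [d > 0]
      because [D >= mD I] with [mD > 0]; so the order intervals
      [[d I, lambda I]] are invariant;
    - if [X1 <= lambda I] is a solution and [u(t) = exp(- r exp(- alpha t))]
      with [alpha lambda = mD - cS lambda^2], then [u X1] is a subsolution.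
      Comparing it with a second solution [X2] such that
      [X1(0) <= exp(r) X2(0)] gives
      [X1(t) <= exp(r exp(- alpha t)) X2(t)], which is the contraction of the
      Thompson metric at the rate [alpha] ([solution_contraction]).

    Solutions exist locally as power series in [t]: the coefficients forced by
    the equation have a geometric majorant that depends on a bound of the
    initial value only ([nbd_coef], [power_series_solution]). As the solution
    stays in an order interval, hence bounded, it extends to all times.

    The stationary point is the limit of a trajectory: a trajectory and its
    time translates are solutions at finite distance, so they approach each
    other exponentially, and the trajectory of the limit is constant
    ([stationary_exists]). *)

(** * Scalars and the real part of the inner product *)

Section Scalars.
Context {R : realType} {k : scalar_kind}.
Implicit Types (r : R) (z w a : scalar_field R k).

Definition re_of : scalar_field R k -> R :=
  match k as k0 return scalar_field R k0 -> R with
  | RealScalars => fun x => x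
  | ComplexScalars => fun x => complex.Re x
  end.

Lemma scalar_of_is_zmod_morphism : zmod_morphism (@scalar_of R k).
Proof. by case: k => //= x y; rewrite rmorphB. Qed.

Lemma scalar_of_is_monoid_morphism : monoid_morphism (@scalar_of R k).
Proof. by case: k => //=; split=> [|x y]; rewrite ?rmorph1 ?rmorphM. Qed.

HB.instance Definition _ := GRing.isZmodMorphism.Build R (scalar_field R k)
  (@scalar_of R k) scalar_of_is_zmod_morphism.
HB.instance Definition _ := GRing.isMonoidMorphism.Build R (scalar_field R k)
  (@scalar_of R k) scalar_of_is_monoid_morphism.

Lemma re_of_is_zmod_morphism : zmod_morphism re_of.
Proof. by rewrite /re_of; case: k => //= -[? ?] [? ?]. Qed.

HB.instance Definition _ := GRing.isZmodMorphism.Build (scalar_field R k) R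
  re_of re_of_is_zmod_morphism.

Lemma re_ofK : cancel (@scalar_of R k) re_of.
Proof. by rewrite /re_of /scalar_of; case: k. Qed.

Lemma re_ofZ r z : re_of (scalar_of k r * z) = r * re_of z.
Proof.
by rewrite /re_of /scalar_of; case: k z => //= -[a b] /=; rewrite mul0r subr0.
Qed.

Lemma re_of_conj z : re_of (scalar_conj z) = re_of z.
Proof. by rewrite /re_of /scalar_conj; case: k z => //= -[a b]. Qed.

Lemma le_scalar_of r1 r2 : (scalar_of k r1 <= scalar_of k r2) = (r1 <= r2).
Proof. by case: k => //=; rewrite lecR. Qed.

Lemma lt_scalar_of r1 r2 : (scalar_of k r1 < scalar_of k r2) = (r1 < r2).
Proof. by case: k => //=; rewrite ltcR. Qed.

Lemma ge0_scalar_ofK z : 0 <= z -> scalar_of k (re_of z) = z.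
Proof.
rewrite /re_of /scalar_of; case: k z => //= z z0.
by apply: RRe_real; exact: ger0_real.
Qed.

Lemma conj_scalar_ofK z : scalar_conj z = z -> scalar_of k (re_of z) = z.
Proof.
rewrite /re_of /scalar_of; case: k z => //= -[a b] [bb].
have -> : b = 0 by lra.
by [].
Qed.

Lemma norm_scalar_of r : `|scalar_of k r| = scalar_of k `|r|.
Proof.
case: k => //=; rewrite normc_def /= expr0n addr0 sqrtr_sqr.
by [].
Qed.

(** Multiplying by the scalars [1] and [i] recovers both coordinates. *)
Lemma re_of_inj z w : (forall a, re_of (a * z) = re_of (a * w)) -> z = w.
Proof.
rewrite /re_of; case: k z w => /= [z w /(_ 1)|[a b] [c d] H].
  by rewrite !mul1r.
have := H (Complex 1 0); have := H (Complex 0 1) => /=.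
by rewrite !mul1r !mul0r !subr0 !sub0r => /oppr_inj -> ->.
Qed.

End Scalars.

Section RealForm.
Context {R : realType} {k : scalar_kind} {E : hilbert_space R k}.
Implicit Types (x y z : E) (r c : R) (A P Q : E -> E).
Local Notation "r %:K" := (scalar_of k r) (at level 2, format "r %:K").

(** A real inner product on [E]; it serves real and complex scalars alike. *)
Definition ip x y : R := re_of (inner E x y).
Definition nr x : R := re_of `|x|.

Lemma ipDl x y z : ip (x + y) z = ip x z + ip y z.
Proof. by rewrite /ip linearDl raddfD. Qed.
Lemma ipNl x y : ip (- x) y = - ip x y.
Proof. by rewrite /ip linearNl raddfN. Qed.
Lemma ipBl x y z : ip (x - y) z = ip x z - ip y z.
Proof. by rewrite ipDl ipNl. Qed.
Lemma ip0l x : ip 0 x = 0.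
Proof. by rewrite /ip linear0l raddf0. Qed.
Lemma ipZl r x y : ip (r%:K *: x) y = r * ip x y.
Proof. by rewrite /ip linearZl_LR /= re_ofZ. Qed.

Lemma innerC x y : inner E x y = scalar_conj (inner E y x).
Proof.
have := @hermitian_subproof _ _ _ _ (inner E) x y.
by rewrite expr0 mul1r.
Qed.

Lemma ipC x y : ip x y = ip y x.
Proof. by rewrite /ip innerC re_of_conj. Qed.
Lemma ipDr x y z : ip z (x + y) = ip z x + ip z y.
Proof. by rewrite !(ipC z) ipDl. Qed.
Lemma ipNr x y : ip y (- x) = - ip y x.
Proof. by rewrite !(ipC y) ipNl. Qed.
Lemma ipBr x y z : ip z (x - y) = ip z x - ip z y.
Proof. by rewrite ipDr ipNr. Qed.
Lemma ip0r x : ip x 0 = 0.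
Proof. by rewrite ipC ip0l. Qed.
Lemma ipZr r x y : ip x (r%:K *: y) = r * ip x y.
Proof. by rewrite ipC ipZl ipC. Qed.

Lemma nrE x : `|x| = (nr x)%:K.
Proof. by rewrite /nr ge0_scalar_ofK. Qed.

Lemma nr_sqr x : nr x ^+ 2 = ip x x.
Proof.
by rewrite /ip -norm_inner nrE -rmorphXn re_ofK.
Qed.

Lemma nr_ge0 x : 0 <= nr x.
Proof. by rewrite -(@le_scalar_of _ k) -nrE rmorph0. Qed.

Lemma ip_ge0 x : 0 <= ip x x.
Proof. by rewrite -nr_sqr sqr_ge0. Qed.

Lemma nr_eq0 x : nr x = 0 -> x = 0.
Proof. by move=> h; apply/normr0_eq0; rewrite nrE h rmorph0. Qed.

Lemma nr0 : nr 0 = 0.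
Proof. by rewrite /nr normr0 raddf0. Qed.

Lemma nr_gt0 x : x <> 0 -> 0 < nr x.
Proof.
move=> x0; rewrite lt_neqAle nr_ge0 andbT eq_sym.
by apply/eqP => /nr_eq0.
Qed.

Lemma nrD x y : nr (x + y) <= nr x + nr y.
Proof. by rewrite -(@le_scalar_of _ k) rmorphD /= -!nrE ler_normD. Qed.

Lemma nrN x : nr (- x) = nr x.
Proof. by rewrite /nr normrN. Qed.

Lemma nrB x y : nr (x - y) <= nr x + nr y.
Proof. by rewrite (le_trans (nrD _ _)) ?nrN. Qed.

Lemma nrBC x y : nr (x - y) = nr (y - x).
Proof. by rewrite -nrN opprB. Qed.

Lemma nrZ r x : nr (r%:K *: x) = `|r| * nr x.
Proof. by rewrite /nr normrZ norm_scalar_of re_ofZ. Qed.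

(* Expanding [0 <= ip (x - r y) (x - r y)] at the optimal [r]. *)
Lemma ip_le x y : ip x y <= nr x * nr y.
Proof.
have [->|/eqP x0] := eqVneq x 0; first by rewrite ip0l nr0 mul0r.
have [->|/eqP y0] := eqVneq y 0; first by rewrite ip0r nr0 mulr0.
have hx := nr_gt0 x0; have hy := nr_gt0 y0.
have := ip_ge0 ((nr y)%:K *: x - (nr x)%:K *: y).
rewrite ipBl !ipBr !ipZl !ipZr (ipC y x) -!nr_sqr => h.
have : 0 <= 2 * (nr x * nr y) * (nr x * nr y - ip x y) by nra.
rewrite pmulr_rge0 ?subr_ge0 // mulr_gt0 // mulr_gt0 //.
Qed.

Lemma ip_norm_le x y : `|ip x y| <= nr x * nr y.
Proof.
rewrite ler_norml ip_le andbT lerNl -ipNl -(nrN x).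
exact: ip_le.
Qed.

Lemma eq_ip x y : (forall z, ip x z = ip y z) -> x = y.
Proof.
move=> h; apply/eqP; rewrite -subr_eq0; apply/eqP/nr_eq0/eqP.
by rewrite -sqrf_eq0 nr_sqr ipBl !h subrr.
Qed.

Lemma opnorm_leP A c : opnorm_le A c <-> forall x, nr (A x) <= c * nr x.
Proof.
split=> h x; have := h x; rewrite !nrE -rmorphM.
  by rewrite le_scalar_of.
by rewrite le_scalar_of.
Qed.

Definition nr_cvg (u : nat -> E) (l : E) :=
  forall e, 0 < e -> exists N, forall n, (N <= n)%N -> nr (u n - l) <= e.

Lemma nr_complete (u : nat -> E) :
  (forall e, 0 < e -> exists N, forall m n, (N <= m)%N -> (N <= n)%N ->
     nr (u m - u n) <= e) -> exists l, nr_cvg u l.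
Proof.
move=> h.
have cu : cauchy (u @ \oo).
  apply/cauchy_ballP => e e0.
  have rK := ge0_scalar_ofK (ltW e0).
  have e2 : 0 < re_of e / 2.
    have : 0 < re_of e by rewrite -(@lt_scalar_of _ k) rK rmorph0.
    lra.
  have [N hN] := h _ e2.
  exists (u @` [set n | (N <= n)%N], u @` [set n | (N <= n)%N]) => /=.
    by split; exists N => // n Nn; exists n.
  move=> [_ _] /= [[x Nx <-] [y Ny <-]]; rewrite -ball_normE /ball_ /=.
  rewrite nrE -rK lt_scalar_of (le_lt_trans (hN _ _ Nx Ny)) //.
  lra.
have /cvg_ex [l ul] : cvg (u @ \oo) by exact: cauchy_cvg.
exists l => e e0.
have e0' : 0 < e%:K by rewrite -(rmorph0 (scalar_of k)) lt_scalar_of.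
have /cvgrPdist_le /(_ _ e0') [N _ hN] := ul.
exists N => n Nn; have := hN n Nn; rewrite /= nrE le_scalar_of nrBC.
by [].
Qed.

Lemma bounded_opP A : bounded_op A <->
  linear A /\ exists2 c, 0 <= c & forall x, nr (A x) <= c * nr x.
Proof.
split=> -[lA hA]; split=> //.
  pose f : {linear E -> E} := HB.pack A (GRing.isLinear.Build _ _ _ _ A lA).
  have /linear_bounded_continuous/linear_boundedP : continuous f by [].
  move=> [c [cr hc]].
  have c1 : c < `|c| + 1.
    by rewrite (le_lt_trans (real_ler_norm cr)) // ltrDl.
  have {}hc x : `|A x| <= (`|c| + 1) * `|x| by exact: hc.
  have c0 : 0 <= `|c| + 1 by rewrite addr_ge0.
  exists (re_of (`|c| + 1)).
    by rewrite -(@le_scalar_of _ k) (ge0_scalar_ofK c0) rmorph0.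
  by move=> x; have := hc x; rewrite -{1}(ge0_scalar_ofK c0) !nrE -rmorphM le_scalar_of.
case: hA => c c0 hA.
pose f : {linear E -> E} := HB.pack A (GRing.isLinear.Build _ _ _ _ A lA).
suff : continuous f by [].
apply/linear_bounded_continuous/linear_boundedP.
exists c%:K; split; first by rewrite ger0_real // -(rmorph0 (scalar_of k)) le_scalar_of.
move=> M cM x; apply: (@le_trans _ _ (c%:K * `|x|)).
  by rewrite !nrE -rmorphM le_scalar_of.
by rewrite ler_wpM2r // ltW.
Qed.

(** Symmetry for the real part suffices since [P] commutes with the scalar
    [i]. *)
Lemma sym_opP P : sym_op P <->
  [/\ linear P, exists2 c, 0 <= c & forall x, nr (P x) <= c * nr x
    & forall x y, ip (P x) y = ip x (P y)].
Proof.
split=> [[/bounded_opP[lP bP] sP]|[lP bP sP]].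
  by split=> // x y; rewrite /ip sP.
split; first exact/bounded_opP.
move=> x y; apply: re_of_inj => a.
have lZ (v : E) b : P (b *: v) = b *: P v.
  have := lP b v 0; have := lP 1 0 0; rewrite !scale1r !addr0 => P0 ->.
  suff -> : P 0 = 0 by rewrite addr0.
  by move: P0 => /(congr1 (fun z => z - P 0)); rewrite addrK subrr => <-.
have h (v w : E) : a * inner E v w = inner E (a *: v) w by rewrite linearZl_LR.
by rewrite !h -lZ; exact: sP.
Qed.

(** The quadratic form of a symmetric operator takes real values. *)
Lemma psd_opP P : psd_op P <-> sym_op P /\ forall x, 0 <= ip (P x) x.
Proof.
split=> -[sP h]; split=> // x; have := h x.
  by move=> h0; rewrite /ip -(@le_scalar_of _ k) rmorph0 ge0_scalar_ofK.
rewrite /ip -(@le_scalar_of _ k) rmorph0 conj_scalar_ofK //.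
by rewrite -innerC; apply/esym; exact: sP.2.
Qed.

End RealForm.
(** * Symmetric operators and their quadratic forms *)

Lemma real_induction (R : realType) (T : R) (P : R -> Prop) :
  P 0 ->
  (forall t, 0 <= t -> t < T -> P t -> exists2 d, 0 < d &
     forall s, t <= s -> s <= T -> s < t + d -> P s) ->
  (forall t, 0 < t -> t <= T -> (forall s, 0 <= s -> s < t -> P s) -> P t) ->
  forall t, 0 <= t -> t <= T -> P t.
Proof.
move=> P0 step lim t0 t00 t0T.
pose A := [set t | 0 <= t <= T /\ forall s, 0 <= s -> s <= t -> P s].
have A0 : A 0.
  split; first by rewrite lexx (le_trans t00 t0T).
  by move=> s s0 s0'; have -> : s = 0 by apply/le_anti; rewrite s0 s0'.
have supA : has_sup A by split; [exists 0|exists T => s [/andP[]]].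
pose m := sup A.
have m0 : 0 <= m by exact: sup_upper_bound.
have mT : m <= T.
  by apply: (ge_sup (ex_intro _ 0 A0)) => s [/andP[]].
have Plt s : 0 <= s -> s < m -> P s.
  move=> s0 sm; have ms0 : 0 < m - s by rewrite subr_gt0.
  have [u [_ Au] su] := sup_adherent ms0 supA.
  by apply: Au => //; rewrite ltW // (le_lt_trans _ su) // -/m; lra.
have Pm : P m.
  have [m0'|m0'] := eqVneq m 0; first by rewrite m0'.
  by apply: lim => //; rewrite lt_neqAle eq_sym m0' m0.
have Ple s : 0 <= s -> s <= m -> P s.
  move=> s0; rewrite le_eqVlt => /orP[/eqP -> //|]; exact: Plt.
have [mT'|mT'] := ltP m T; last by apply: Ple => //; lra.
have [d d0 Pd] := step m m0 mT' Pm.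
pose u := Num.min (m + d / 2) T.
have um : m < u by rewrite lt_min mT' andbT; lra.
have : A u.
  split; first by rewrite (le_trans m0 (ltW um)) /= ge_min lexx orbT.
  move=> s s0 su; have [sm|sm] := leP s m; first exact: Ple.
  apply: Pd (ltW sm) _ _; first by rewrite (le_trans su) // ge_min lexx orbT.
  rewrite (le_lt_trans su) // gt_min; apply/orP; left; lra.
by move=> /(sup_upper_bound supA); rewrite leNgt um.
Qed.

Section Operators.
Context {R : realType} {k : scalar_kind} {E : hilbert_space R k}.
Implicit Types (x y z : E) (r c : R) (A P Q S D : E -> E).
Local Notation "r %:K" := (scalar_of k r) (at level 2, format "r %:K").

(** [opnorm_le] with a real norm in place of the scalar-valued one. *)
Definition nbd A c := forall x, nr (A x) <= c * nr x.

Lemma nbdW A c c' : c <= c' -> nbd A c -> nbd A c'.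
Proof. by move=> cc h x; apply: le_trans (h x) _; rewrite ler_wpM2r ?nr_ge0. Qed.

Lemma nbd_comp A P c c' : 0 <= c -> nbd A c -> nbd P c' -> nbd (A \o P) (c * c').
Proof.
move=> c0 hA hP x /=; apply: le_trans (hA _) _.
by rewrite -mulrA ler_wpM2l.
Qed.

Lemma nbdD A P c c' : nbd A c -> nbd P c' -> nbd (A + P) (c + c').
Proof. by move=> hA hP x; apply: le_trans (nrD _ _) _; rewrite mulrDl lerD. Qed.

Lemma nbdN A c : nbd A c -> nbd (- A) c.
Proof. by move=> hA x; rewrite nrN. Qed.

Lemma nbdZ A c r : nbd A c -> nbd (scale_op r A) (`|r| * c).
Proof.
by move=> hA x; rewrite [nr _]nrZ -mulrA ler_wpM2l.
Qed.

Lemma nbd_sum I (s : seq I) (F : I -> E -> E) (f : I -> R) :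
  (forall i, nbd (F i) (f i)) -> nbd (\sum_(i <- s) F i) (\sum_(i <- s) f i).
Proof.
move=> h; elim/big_ind2: _ => [|????|i _]; [|exact: nbdD|exact: h].
by move=> x; rewrite [nr _]nr0 mul0r.
Qed.

Lemma lin0 A : linear A -> A 0 = 0.
Proof.
move=> lA; have := lA 1 0 0; rewrite !scale1r !addr0.
by move=> /(congr1 (fun z => z - A 0)); rewrite addrK subrr => <-.
Qed.

Lemma linD A x y : linear A -> A (x + y) = A x + A y.
Proof. by move=> lA; have := lA 1 x y; rewrite !scale1r. Qed.

Lemma linZ A a x : linear A -> A (a *: x) = a *: A x.
Proof. by move=> lA; have := lA a x 0; rewrite (lin0 lA) !addr0. Qed.

Lemma linB A x y : linear A -> A (x - y) = A x - A y.
Proof. by move=> lA; rewrite (linD _ _ lA) -scaleN1r (linZ _ _ lA) scaleN1r. Qed.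

Lemma lin_sum A I (s : seq I) (F : I -> E) : linear A ->
  A (\sum_(i <- s) F i) = \sum_(i <- s) A (F i).
Proof.
by move=> lA; elim/big_rec2: _ => [|i a b _ <-]; rewrite ?(lin0 lA) ?(linD _ _ lA).
Qed.

Lemma sym_lin P : sym_op P -> linear P.
Proof. by move=> /sym_opP[]. Qed.

Lemma sym_bd P : sym_op P -> exists2 c, 0 <= c & nbd P c.
Proof. by move=> /sym_opP[]. Qed.

Lemma sym_ip P x y : sym_op P -> ip (P x) y = ip x (P y).
Proof. by move=> /sym_opP[]. Qed.

Lemma symD P Q : sym_op P -> sym_op Q -> sym_op (P + Q).
Proof.
move=> /sym_opP[lP [c c0 cP] sP] /sym_opP[lQ [d d0 cQ] sQ]; apply/sym_opP; split.
- move=> a x y; rewrite !fctE lP lQ scalerDr !addrA; congr (_ + _).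
  by rewrite addrAC.
- by exists (c + d); [exact: addr_ge0|exact: nbdD].
- by move=> x y; rewrite !fctE ipDl ipDr sP sQ.
Qed.

Lemma symN P : sym_op P -> sym_op (- P).
Proof.
move=> /sym_opP[lP [c c0 cP] sP]; apply/sym_opP; split.
- by move=> a x y; rewrite !fctE lP opprD scalerN.
- by exists c => //; exact: nbdN.
- by move=> x y; rewrite !fctE ipNl ipNr sP.
Qed.

Lemma symB P Q : sym_op P -> sym_op Q -> sym_op (P - Q).
Proof. by move=> sP sQ; apply: symD => //; exact: symN. Qed.

Lemma symZ P r : sym_op P -> sym_op (scale_op r P).
Proof.
move=> /sym_opP[lP [c c0 cP] sP]; apply/sym_opP; split.
- move=> a x y; rewrite /scale_op !fctE lP scalerDr; congr (_ + _).
  by rewrite !scalerA mulrC.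
- exists (`|r| * c); first by rewrite mulr_ge0.
  exact: nbdZ.
- by move=> x y; rewrite /scale_op !fctE ipZl ipZr sP.
Qed.

Lemma sym_scalar r : sym_op (@scalar_op R k E r).
Proof.
apply: symZ; apply/sym_opP; split=> //.
by exists 1 => // x; rewrite mul1r.
Qed.

Lemma sym0 : sym_op (0 : E -> E).
Proof.
apply/sym_opP; split.
- by move=> a x y; rewrite -[LHS]/(0 : E) -[RHS]/(a *: 0 + 0 : E) scaler0 addr0.
- by exists 0 => // x; rewrite [nr _]nr0 mul0r.
- by move=> x y; rewrite [LHS]ip0l [RHS]ip0r.
Qed.

Lemma scale_half P : scale_op (1 / 2) (P + P) = P.
Proof.
apply/funext => x; rewrite /scale_op !fctE scalerDr -scalerDl -rmorphD.
have -> : 1 / 2 + 1 / 2 = 1 :> R by lra.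
by rewrite rmorph1 scale1r.
Qed.

(** Polarization: a symmetric operator is controlled by its quadratic form. *)
Lemma sym_nbd P c : sym_op P -> (forall x, `|ip (P x) x| <= c * ip x x) -> nbd P c.
Proof.
move=> sP h x; have lP := sym_lin sP.
have [->|/eqP x0] := eqVneq x 0; first by rewrite (lin0 lP) !nr0 mulr0.
have [->|/eqP Px0] := eqVneq (P x) 0; first rewrite nr0.
  have := h x; have := ip_ge0 x; rewrite -nr_sqr; have := nr_gt0 x0.
  by move=> ? ? ?; have := normr_ge0 (ip (P x) x); nra.
have a0 := nr_gt0 x0; have b0 := nr_gt0 Px0.
set a := nr x in a0 *; set b := nr (P x) in b0 *.
(* The vectors [x] and [(a / b) P x] have the same norm. *)
pose y := (a / b)%:K *: P x.
have e : ip (P (x + y)) (x + y) - ip (P (x - y)) (x - y) = 4 * (a * b).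
  rewrite (linB _ _ lP) (linD _ _ lP) !ipDl !ipDr !ipNl !ipNr (sym_ip y x sP) (ipC y).
  have -> : ip (P x) y = a * b.
    by rewrite /y ipZr -nr_sqr -/b; field; rewrite gt_eqF.
  ring.
have q : ip (x + y) (x + y) + ip (x - y) (x - y) = 4 * a ^+ 2.
  rewrite !ipDl !ipDr !ipNl !ipNr.
  have -> : ip y y = a ^+ 2.
    by rewrite /y ipZl ipZr -(nr_sqr (P x)) -/b; field; rewrite gt_eqF.
  by rewrite -(nr_sqr x) -/a; ring.
have := h (x + y); have := h (x - y).
rewrite !ler_norml => /andP[h1 _] /andP[_ h2].
have : 4 * (a * b) <= c * (4 * a ^+ 2) by rewrite -e -q; nra.
move=> h4; have : 0 <= a * (c * a - b) by nra.
by rewrite pmulr_rge0 // subr_ge0.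
Qed.

Lemma le_opP P Q : sym_op P -> sym_op Q ->
  le_op P Q <-> forall x, ip (P x) x <= ip (Q x) x.
Proof.
move=> sP sQ; rewrite /le_op; split=> [/psd_opP[_ h] x|h].
  by have := h x; rewrite !fctE ipBl subr_ge0.
apply/psd_opP; split=> [|x]; first exact: symB.
by rewrite !fctE ipBl subr_ge0.
Qed.

Lemma le_op_form P Q x : le_op P Q -> ip (P x) x <= ip (Q x) x.
Proof. by move=> /psd_opP[_ /(_ x)]; rewrite !fctE ipBl subr_ge0. Qed.

Lemma le_op_anti P Q : sym_op P -> sym_op Q -> le_op P Q -> le_op Q P -> P = Q.
Proof.
move=> sP sQ pq qp; apply/funext => x; apply/eqP; rewrite -subr_eq0; apply/eqP.
apply: nr_eq0; apply/le_anti; rewrite nr_ge0 andbT -(mul0r (nr x)).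
apply: (@sym_nbd (P - Q)); first exact: symB.
move=> y; rewrite mul0r !fctE ipBl normr_le0 subr_eq0; apply/eqP/le_anti.
by rewrite !le_op_form.
Qed.

Lemma ip_scalar_op c x : ip (scalar_op c x) x = c * ip x x.
Proof. by rewrite /scalar_op /scale_op !fctE ipZl. Qed.

Lemma ip_scale_op c P x y : ip (scale_op c P x) y = c * ip (P x) y.
Proof. by rewrite /scale_op !fctE ipZl. Qed.

(** Moving [P] by [d] in norm changes its form by at most [d], and [- d I]
    realizes this change. *)
Lemma pos_opP P : pos_op P <->
  sym_op P /\ exists2 d, 0 < d & forall x, d * ip x x <= ip (P x) x.
Proof.
split=> -[sP]; move=> [e e0 h]; split=> //; exists e => //.
  move=> x; have /psd_opP[_ /(_ x)] : psd_op (P - scalar_op e).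
    apply: h; first by apply: symB => //; exact: sym_scalar.
    apply/opnorm_leP => y.
    by rewrite /scalar_op /scale_op !fctE addrAC subrr add0r nrN nrZ gtr0_norm.
  by rewrite !fctE ipBl ip_scalar_op subr_ge0.
move=> Q sQ /opnorm_leP hQ; apply/psd_opP; split=> // x.
have := ip_norm_le ((Q - P) x) x; rewrite !fctE ipBl => hn.
have := hQ x; have := h x; have := nr_ge0 x; rewrite -nr_sqr !fctE.
move=> n0 h1 h2.
have h3 : `|ip (Q x) x - ip (P x) x| <= e * nr x ^+ 2.
  by apply: le_trans hn _; rewrite expr2 mulrA ler_wpM2r.
by move: h3; rewrite ler_norml => /andP[]; lra.
Qed.

Lemma pos_sym P : pos_op P -> sym_op P.
Proof. by case. Qed.

(** If [A] had no adjoint, [adjoint A] would be the default value [A], and the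
    symmetry of [A + A] would make [A] its own adjoint. *)
Lemma adjoint_exists A c : bounded_op A -> le_op (A + adjoint A) (scalar_op c) ->
  bounded_op (adjoint A) /\ forall x y, ip (A x) y = ip x (adjoint A y).
Proof.
move=> bA hA.
suff : bounded_op (adjoint A) /\
    forall x y, inner E (A x) y = inner E x (adjoint A y).
  by move=> [bB h]; split=> // x y; rewrite /ip h.
rewrite /adjoint; case: xgetP => [B _ //|noadj].
case: (noadj A); split=> //; apply: (proj2 (_ : sym_op A)).
have aA : adjoint A = A by rewrite /adjoint; case: xgetP => // B _ /noadj.
move: hA; rewrite aA => -[/(symB (sym_scalar c)) + _].
by rewrite opprB addrC subrK => /(symZ (1 / 2)); rewrite scale_half.
Qed.

End Operators.
(** * Order preservation for the Riccati equation *)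

Section Comparison.
Context {R : realType} {k : scalar_kind} {E : hilbert_space R k}.
Implicit Types (x y z : E) (r c t s : R) (A P Q S D : E -> E).
Local Notation "r %:K" := (scalar_of k r) (at level 2, format "r %:K").

(** Differentiability of the quadratic forms of [Y], uniform on the unit ball;
    one-sided at the endpoints of [[0, T]]. *)
Definition form_deriv T (Y : R -> E -> E) t (g : E -> R) :=
  forall e, 0 < e -> exists2 d, 0 < d &
    forall s, 0 <= s -> s <= T -> `|s - t| < d -> forall x,
      `|ip (Y s x) x - ip (Y t x) x - (s - t) * g x| <= e * `|s - t| * ip x x.

Lemma ge0_limit (a b : R) : 0 <= b ->
  (forall e, 0 < e -> 0 <= a + e * b) -> 0 <= a.
Proof.
move=> b0 h; apply/ler_addgt0Pr => e e0.
have b1 : 0 < b + 1 by lra.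
apply: le_trans (h (e / (b + 1)) _) _; first by rewrite divr_gt0.
rewrite lerD2l mulrAC ler_pdivrMr //; nra.
Qed.

Lemma form_expand P x y r : sym_op P ->
  ip (P (x + r%:K *: y)) (x + r%:K *: y)
  = ip (P x) x + 2 * r * ip (P x) y + r ^+ 2 * ip (P y) y.
Proof.
move=> sP; have lP := sym_lin sP.
rewrite (linD _ _ lP) (linZ _ _ lP) !ipDl !ipDr !ipZl !ipZr.
by rewrite (sym_ip y x sP) (ipC y (P x)); ring.
Qed.

Lemma ip_expand x y r :
  ip (x + r%:K *: y) (x + r%:K *: y) = ip x x + 2 * r * ip x y + r ^+ 2 * ip y y.
Proof. by rewrite !ipDl !ipDr !ipZl !ipZr (ipC y x); ring. Qed.

Lemma nbd_ip_norm A c x : nbd A c -> `|ip (A x) x| <= c * ip x x.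
Proof.
move=> h; apply: le_trans (ip_norm_le _ _) _.
by rewrite -nr_sqr expr2 mulrA ler_wpM2r ?nr_ge0.
Qed.

(** If [Z' = C^* Z + Z C + G] with [G >= 0], then [Z] stays positive: when [Z]
    is positive, [Z(t + h)] is, up to second order in [h], the positive form
    [x |-> <Z(t) (x + h C x), x + h C x>] plus [h G]. The second-order error is
    absorbed by the perturbation [Z + eta exp(L t)]. *)
Lemma form_psd_stays T B K (Z : R -> E -> E) :
  0 <= B -> 0 <= K ->
  (forall t, 0 <= t -> t <= T ->
    [/\ sym_op (Z t), nbd (Z t) B & exists (C : E -> E) (G : E -> R),
        [/\ nbd C K, forall x, 0 <= G x &
            form_deriv T Z t (fun x => 2 * ip (Z t x) (C x) + G x)]]) ->
  (forall x, 0 <= ip (Z 0 x) x) ->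
  forall t, 0 <= t -> t <= T -> forall x, 0 <= ip (Z t x) x.
Proof.
move=> B0 K0 H Z0 t0 t00 t0T x0.
pose L := 2 * K + 1.
apply: (@ge0_limit _ (expR (L * t0) * ip x0 x0)).
  by rewrite mulr_ge0 ?expR_ge0 ?ip_ge0.
move=> eta eta0; rewrite mulrA.
have L0 : 0 < L by rewrite /L; lra.
pose w s := eta * expR (L * s).
have w0 s : 0 < w s by rewrite mulr_gt0 ?expR_gt0.
pose P s := forall x, 0 <= ip (Z s x) x + w s * ip x x.
suff : P t0 by exact.
move: {x0} t0 t00 t0T; apply: real_induction => [x|t t00 tT Pt|t t00 tT Pt x].
- by rewrite addr_ge0 // mulr_ge0 ?ip_ge0 // ltW.
- have [sZ bZ [C [G [bC G0 dZ]]]] := H _ t00 (ltW tT).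
  have wt := w0 t; set w' := w t in wt *.
  (* [B'] bounds the second-order term of the expansion at [x + h C x]. *)
  pose B' := (B + w') * K ^+ 2.
  have B'0 : 0 <= B' by rewrite mulr_ge0 ?sqr_ge0 //; lra.
  have w2 : 0 < w' / 2 by lra.
  have [d d0 hd] := dZ _ w2.
  have d'0 : 0 < w' / (2 * (B' + 1)) by rewrite divr_gt0 //; lra.
  exists (Num.min d (w' / (2 * (B' + 1)))); first by rewrite lt_min d0.
  move=> s ts sT sd x; pose h := s - t.
  have h0 : 0 <= h by rewrite /h; lra.
  have hd1 : h < d /\ h < w' / (2 * (B' + 1)).
    have : h < Num.min d (w' / (2 * (B' + 1))) by rewrite /h; lra.
    by rewrite lt_min => /andP[].
  case: hd1 => hd1; rewrite ltr_pdivlMr; last lra.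
  move=> hd2.
  have s0 : 0 <= s by lra.
  have := hd s s0 sT; rewrite -/h ger0_norm // => /(_ hd1 x).
  rewrite ler_norml => /andP[q1 _].
  have ws : w' * (1 + L * h) <= w s.
    rewrite /w /w' /w -mulrA ler_pM2l //.
    have -> : L * s = L * t + L * h by rewrite /h; ring.
    by rewrite expRD ler_pM2l ?expR_gt0 // expR_ge1Dx.
  have := Pt (x + h%:K *: C x); rewrite form_expand // ip_expand -/w' => q2.
  have nC := bC x; have n0 := nr_ge0 x; have nC0 := nr_ge0 (C x).
  have q3 : ip (C x) (C x) <= K ^+ 2 * ip x x.
    by rewrite -!nr_sqr -exprMn lerXn2r ?nnegrE // mulr_ge0.
  have q4 : ip (Z t (C x)) (C x) <= B * (K ^+ 2 * ip x x).
    have := nbd_ip_norm (C x) bZ; rewrite ler_norml => /andP[_ h1].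
    by apply: le_trans h1 _; rewrite ler_wpM2l.
  have q5 : ip x (C x) <= K * ip x x.
    rewrite -nr_sqr; apply: le_trans (ip_le _ _) _.
    by rewrite expr2 mulrCA ler_wpM2l.
  have N0 := ip_ge0 x; set N := ip x x in q3 q4 q5 q1 q2 N0 *.
  have Gx := G0 x.
  have hh := sqr_ge0 h.
  have r4 : h ^+ 2 * ip (Z t (C x)) (C x) <= h ^+ 2 * (B * (K ^+ 2 * N)).
    by rewrite ler_wpM2l.
  have r3 : w' * (h ^+ 2 * ip (C x) (C x)) <= w' * (h ^+ 2 * (K ^+ 2 * N)).
    by rewrite ler_pM2l // ler_wpM2l.
  have r5 : w' * (2 * h * ip x (C x)) <= w' * (2 * h * (K * N)).
    by rewrite ler_pM2l // ler_wpM2l // mulr_ge0.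
  have r6 : w' * (1 + L * h) * N <= w s * N by rewrite ler_wpM2r.
  have r7 : 0 <= h * G x by rewrite mulr_ge0.
  have r8 : 0 <= (h * N) * (w' / 2 - h * B').
    rewrite mulr_ge0 ?mulr_ge0 //; lra.
  rewrite /B' /L in r8 r6 hd2; lra.
- have [sZ bZ [C [G [bC G0 dZ]]]] := H _ (ltW t00) tT.
  rewrite leNgt; apply/negP => v0.
  have [d d0 hd] := dZ _ ltr01.
  pose g y := 2 * ip (Z t y) (C y) + G y; set v := (_ + _) in v0.
  have N0 := ip_ge0 x; have g0 := normr_ge0 (g x).
  pose m := ip x x + `|g x| + 1.
  have m0 : 0 < m by rewrite /m; lra.
  pose h := Num.min (d / 2) (Num.min t (- v / (2 * m))).
  have h0 : 0 < h.
    by rewrite !lt_min t00 divr_gt0 ?divr_gt0 ?oppr_gt0 // mulr_gt0.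
  have [hd1 ht hv] : [/\ h <= d / 2, h <= t & h <= - v / (2 * m)].
    by rewrite /h !ge_min !lexx ?orbT; split.
  have s0 : 0 <= t - h by lra.
  have sT : t - h <= T by lra.
  have := hd (t - h) s0 sT.
  have -> : t - h - t = - h by ring.
  rewrite normrN gtr0_norm // => /(_ _ x); rewrite -/(g x) => hq.
  have : h < d by lra.
  move=> /hq; rewrite ler_norml => /andP[_ q1].
  have : t - h < t by lra.
  move=> /(Pt _ s0) /(_ x).
  have ws : w (t - h) <= w t.
    rewrite /w ler_pM2l // ler_expR ler_pM2l //; lra.
  have r1 : w (t - h) * ip x x <= w t * ip x x by rewrite ler_wpM2r.
  have r2 : h * - g x <= h * `|g x|.
    by rewrite ler_wpM2l ?(ltW h0) // -normrN ler_norm.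
  move: hv; rewrite ler_pdivlMr ?mulr_gt0 // => r3.
  move: r3 v0; rewrite /m /v; lra.
Qed.

Variables A D S : E -> E.
Hypothesis bA : bounded_op A.
Hypothesis bA' : bounded_op (adjoint A).
Hypothesis adjA : forall x y, ip (A x) y = ip x (adjoint A y).
Hypothesis sD : sym_op D.
Hypothesis sS : sym_op S.

(** The quadratic form of the right-hand side of the Riccati equation. *)
Definition ric_form P x := 2 * ip (P x) (A x) + ip (D x) x - ip (S (P x)) (P x).

Lemma riccati_rhs_form P x : sym_op P ->
  ip (riccati_rhs A D S P x) x = ric_form P x.
Proof.
move=> sP; rewrite /riccati_rhs !fctE /= ipBl !ipDl /ric_form.
rewrite (sym_ip (A x) x sP) (ipC (adjoint A _)) -adjA.
rewrite (sym_ip (S (P x)) x sP) (ipC (A x)).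
ring.
Qed.

Definition subsolution T (Y : R -> E -> E) := forall t, 0 <= t -> t <= T ->
  sym_op (Y t) /\
  exists2 g, form_deriv T Y t g & forall x, g x <= ric_form (Y t) x.

Definition supersolution T (Y : R -> E -> E) := forall t, 0 <= t -> t <= T ->
  sym_op (Y t) /\
  exists2 g, form_deriv T Y t g & forall x, ric_form (Y t) x <= g x.

(** The difference [Z] of a super- and a subsolution satisfies
    [Z' >= C^* Z + Z C] with [C = A - S Y1 - S Z / 2]. *)
Lemma comparison T B (Y1 Y2 : R -> E -> E) :
  subsolution T Y1 -> supersolution T Y2 -> 0 <= B ->
  (forall t, 0 <= t -> t <= T -> nbd (Y1 t) B /\ nbd (Y2 t) B) ->
  (forall x, ip (Y1 0 x) x <= ip (Y2 0 x) x) ->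
  forall t, 0 <= t -> t <= T -> forall x, ip (Y1 t x) x <= ip (Y2 t x) x.
Proof.
move=> h1 h2 B0 hB h0 t t0 tT x.
have /bounded_opP[_ [a a0 ha]] := bA; have [c c0 hc] := sym_bd sS.
pose Z t := Y2 t - Y1 t.
suff : 0 <= ip (Z t x) x by rewrite /Z !fctE ipBl subr_ge0.
have BB : 0 <= B + B by lra.
move: x; apply: (@form_psd_stays T (B + B) (a + c * B + `|1 / 2| * (c * (B + B)))
  Z) t0 tT => //; first by rewrite !addr_ge0 ?mulr_ge0.
  move=> {}t t0 tT; have [s1 [g1 d1 l1]] := h1 _ t0 tT.
  have [s2 [g2 d2 l2]] := h2 _ t0 tT.
  have [b1 b2] := hB _ t0 tT.
  have bZ : nbd (Z t) (B + B) by apply: nbdD => //; exact: nbdN.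
  split=> //; first exact: symB.
  pose C := A - (S \o Y1 t) - scale_op (1 / 2) (S \o Z t).
  exists C, (fun x => g2 x - g1 x - 2 * ip (Z t x) (C x)); split.
  - apply: nbdD; first apply: nbdD => //.
      by apply: nbdN; exact: nbd_comp.
    by apply: nbdN; apply: nbdZ; exact: nbd_comp.
  - move=> x; have := l1 x; have := l2 x; rewrite /ric_form /C /Z.
    rewrite /scale_op !fctE /=.
    set y1 := Y1 t x; have [z ->] : exists z, Y2 t x = y1 + z.
      by exists (Y2 t x - y1); rewrite addrC subrK.
    have -> : y1 + z - y1 = z by rewrite addrC addKr.
    have lS := sym_lin sS.
    rewrite (linD _ _ lS) !(ipDl, ipDr, ipNl, ipNr) !ipZr (sym_ip z y1 sS).
    by have := ipC z (S y1); have := ipC z (S z); lra.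
  - move=> e e0; have e2 : 0 < e / 2 by lra.
    have [dl1 dl10 k1] := d1 _ e2; have [dl2 dl20 k2] := d2 _ e2.
    exists (Num.min dl1 dl2); first by rewrite lt_min dl10.
    move=> s s0 sT; rewrite lt_min => /andP[sd1 sd2] x.
    have := k1 s s0 sT sd1 x; have := k2 s s0 sT sd2 x.
    rewrite /Z !fctE !ipBl => j2 j1.
    rewrite [X in `|X|](_ : _ = (ip (Y2 s x) x - ip (Y2 t x) x - (s - t) * g2 x)
      - (ip (Y1 s x) x - ip (Y1 t x) x - (s - t) * g1 x)); last by ring.
    by apply: le_trans (ler_normB _ _) _; lra.
by move=> x; rewrite /Z !fctE ipBl subr_ge0.
Qed.

End Comparison.
(** * Uniqueness, invariance and contraction *)

Section Solutions.
Context {R : realType} {k : scalar_kind} {E : hilbert_space R k}.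
Implicit Types (x y z : E) (r c t s : R) (P Q : E -> E) (X Y : R -> E -> E)
  (J : set R).
Local Notation "r %:K" := (scalar_of k r) (at level 2, format "r %:K").

Definition op_deriv J X t (V : E -> E) :=
  forall e, 0 < e -> exists2 d, 0 < d & forall s, J s -> `|s - t| < d ->
    nbd (X s - X t - scale_op (s - t) V) (e * `|s - t|).

Lemma in_seg (T t : R) : `[0, T]%classic t <-> 0 <= t /\ t <= T.
Proof. by rewrite /= in_itv /=; split=> [/andP[]|[-> ->]]. Qed.

Lemma op_deriv_form T X t V : op_deriv `[0, T] X t V ->
  form_deriv T X t (fun x => ip (V x) x).
Proof.
move=> h e e0; have [d d0 hd] := h e e0; exists d => // s s0 sT sd x.
have sJ : `[0, T]%classic s by apply/in_seg.
have := nbd_ip_norm x (hd s sJ sd); rewrite !fctE !ipBl ip_scale_op.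
by [].
Qed.

Lemma form_deriv_cst T P t : form_deriv T (fun=> P) t (fun=> 0).
Proof.
move=> e e0; exists 1 => // s _ _ _ x.
by rewrite subrr mulr0 subrr normr0 !mulr_ge0 ?ip_ge0 // ltW.
Qed.

Lemma form_deriv_scale T X t g (u : R -> R) (u' V B : R) :
  0 <= V -> (forall x, `|g x| <= V * ip x x) ->
  0 <= B -> (forall x, `|ip (X t x) x| <= B * ip x x) ->
  (forall e, 0 < e -> exists2 d, 0 < d &
     forall s, `|s - t| < d -> `|u s - u t - (s - t) * u'| <= e * `|s - t|) ->
  form_deriv T X t g ->
  form_deriv T (fun s => scale_op (u s) (X s)) t
    (fun x => u' * ip (X t x) x + u t * g x).
Proof.
move=> V0 hg B0 hX hu hd e e0.
pose a := `|u t| + B + (`|u'| + 1) * (V + 1) + 1.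
have u0 := normr_ge0 (u t); have u'0 := normr_ge0 u'.
have c0 : 0 <= (`|u'| + 1) * (V + 1) by rewrite mulr_ge0 ?addr_ge0.
have a0 : 0 < a by rewrite /a; lra.
pose e1 := Num.min 1 (e / a).
have e10 : 0 < e1 by rewrite lt_min ltr01 divr_gt0.
have [d1 d10 h1] := hu _ e10; have [d2 d20 h2] := hd _ e10.
exists (Num.min e1 (Num.min d1 d2)); first by rewrite lt_min e10 lt_min d10.
move=> s s0 sT; rewrite lt_min => /andP[he]; rewrite lt_min => /andP[hd1 hd2] x.
have k1 := h1 s hd1; have k2 := h2 s s0 sT hd2 x.
rewrite !ip_scale_op; move: k1 k2 (hg x) (hX x).
set q := ip (X s x) x; set p := ip (X t x) x; set N := ip x x.
set h := s - t; move=> k1 k2 kg kp.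
have N0 : 0 <= N := ip_ge0 x.
have hh := normr_ge0 h.
have e11 : e1 <= 1 by rewrite /e1 ge_min lexx.
have e1a : e1 * a <= e by rewrite -ler_pdivlMr // /e1 ge_min lexx orbT.
have k3 : `|u s - u t| <= (`|u'| + 1) * `|h|.
  rewrite -(subrK (h * u') (u s - u t)).
  apply: le_trans (ler_normD _ _) _; rewrite normrM.
  have := ler_wpM2r hh e11; lra.
have k4 : `|q - p| <= (V + 1) * (`|h| * N).
  rewrite -(subrK (h * g x) (q - p)).
  apply: le_trans (ler_normD _ _) _; rewrite normrM.
  have := ler_wpM2r (mulr_ge0 hh N0) e11.
  have := ler_wpM2l hh kg; lra.
have -> : u s * q - u t * p - h * (u' * p + u t * g x) =
  u t * (q - p - h * g x) + (u s - u t - h * u') * p + (u s - u t) * (q - p).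
  by ring.
apply: le_trans (ler_normD _ _) _.
apply: le_trans (lerD (ler_normD _ _) (lexx _)) _.
rewrite !normrM.
have j1 : `|u t| * `|q - p - h * g x| <= `|u t| * (e1 * `|h| * N).
  exact: ler_wpM2l.
have j2 : `|u s - u t - h * u'| * `|p| <= (e1 * `|h|) * (B * N).
  by apply: ler_pM.
have j3 : `|u s - u t| * `|q - p| <= ((`|u'| + 1) * `|h|) * ((V + 1) * (`|h| * N)).
  by apply: ler_pM.
have j4 : ((`|u'| + 1) * `|h|) * ((V + 1) * (`|h| * N)) <=
   e1 * (((`|u'| + 1) * (V + 1)) * (`|h| * N)).
  have -> : ((`|u'| + 1) * `|h|) * ((V + 1) * (`|h| * N)) =
    `|h| * (((`|u'| + 1) * (V + 1)) * (`|h| * N)) by ring.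
  by apply: ler_wpM2r (ltW he); rewrite mulr_ge0 // mulr_ge0.
have j5 : e1 * a * (`|h| * N) <= e * (`|h| * N).
  by rewrite ler_wpM2r // mulr_ge0.
have j6 : 0 <= e1 * (`|h| * N) by rewrite !mulr_ge0 // ltW.
rewrite /a in j5; lra.
Qed.

Lemma deriv_eps (f : R -> R) t (f' : R) : is_derive t 1 f f' ->
  forall e, 0 < e -> exists2 d, 0 < d &
     forall s, `|s - t| < d -> `|f s - f t - (s - t) * f'| <= e * `|s - t|.
Proof.
move=> [df dv] e e0.
have /cvgrPdist_le /(_ e e0) : (fun h => h^-1 *: (f (h *: 1 + t) - f t)) @ 0^' --> f'.
  by rewrite -dv; exact: df.
rewrite near_withinE => /nbhs_ballP[d /= d0 hd]; exists d => // s sd.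
have [->|st] := eqVneq s t; first by rewrite !subrr mul0r subrr normr0 mulr0.
have st' : s - t != 0 by rewrite subr_eq0.
have := hd (s - t); rewrite -ball_normE /ball_ /= sub0r normrN => /(_ sd st').
rewrite /GRing.scale /= mulr1 subrK => h.
have -> : f s - f t - (s - t) * f' = - (f' - (s - t)^-1 * (f s - f t)) * (s - t).
  by field.
by rewrite normrM normrN ler_wpM2r.
Qed.

Variables A D S : E -> E.
Hypothesis bA : bounded_op A.
Hypothesis bA' : bounded_op (adjoint A).
Hypothesis adjA : forall x y, ip (A x) y = ip x (adjoint A y).
Hypothesis sD : sym_op D.
Hypothesis sS : sym_op S.
Local Notation rhs := (riccati_rhs A D S).

Lemma sym_lyapunov P : sym_op P -> sym_op ((adjoint A \o P) + (P \o A)).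
Proof.
move=> sP; have /sym_opP[lP [c c0 cP] _] := sP.
have /bounded_opP[lA [a a0 ha]] := bA; have /bounded_opP[lB [b b0 hb]] := bA'.
apply/sym_opP; split.
- move=> r x y; rewrite !fctE /= lA !lP lB scalerDr !addrA; congr (_ + _).
  by rewrite addrAC.
- exists (b * c + c * a); first by rewrite addr_ge0 ?mulr_ge0.
  by apply: nbdD; exact: nbd_comp.
- move=> x y; rewrite !fctE /= ipDl ipDr (ipC (adjoint A (P x))) -adjA (ipC (A y)).
  by rewrite -(sym_ip x (A y) sP) (sym_ip (A x) y sP) adjA addrC.
Qed.

(** Symmetrized so that it also covers the terms [(i, n - i)] and [(n - i, i)]
    of a Cauchy product. *)
Lemma sym_sandwich P Q U : sym_op P -> sym_op Q -> sym_op U ->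
  sym_op ((P \o U \o Q) + (Q \o U \o P)).
Proof.
move=> sP sQ sU; have /sym_opP[lP [c c0 cP] _] := sP.
have /sym_opP[lQ [a a0 cQ] _] := sQ; have /sym_opP[lU [b b0 cU] _] := sU.
apply/sym_opP; split.
- move=> r x y; rewrite !fctE /= !(lP, lQ, lU) scalerDr !addrA; congr (_ + _).
  by rewrite addrAC.
- exists (c * b * a + a * b * c); first by rewrite addr_ge0 ?mulr_ge0.
  by apply: nbdD; (apply: nbd_comp => //; [exact: mulr_ge0|exact: nbd_comp]).
- move=> x y; rewrite !fctE /= ipDl ipDr !(sym_ip _ _ sP, sym_ip _ _ sQ, sym_ip _ _ sU).
  by rewrite addrC.
Qed.

Lemma sym_rhs P : sym_op P -> sym_op (rhs P).
Proof.
move=> sP; apply: symB; first by apply: symD => //; exact: sym_lyapunov.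
rewrite -(scale_half (P \o S \o P)).
by apply: symZ; exact: sym_sandwich.
Qed.

Lemma riccati_solutionP J P X : riccati_solution A D S J P X <->
  X 0 = P /\ forall t, J t -> sym_op (X t) /\ op_deriv J X t (rhs (X t)).
Proof.
split=> -[X0 h]; split=> // t Jt; have [sX dX] := h t Jt; split=> //.
  move=> e e0; have /nbhs_ballP[d /= d0 hd] := dX e e0.
  exists d => // s Js sd; apply/opnorm_leP; apply: hd => //.
  by rewrite -ball_normE /ball_ /= distrC.
move=> e e0; have [d d0 hd] := dX e e0; apply/nbhs_ballP; exists d => // s.
rewrite -ball_normE /ball_ /= distrC => sd Js; apply/opnorm_leP; exact: hd.
Qed.

Lemma solution_sub J J' P X : (forall t, J' t -> J t) ->
  riccati_solution A D S J P X -> riccati_solution A D S J' P X.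
Proof.
move=> JJ /riccati_solutionP[X0 h]; apply/riccati_solutionP; split=> // t Jt.
have [sX dX] := h t (JJ _ Jt); split=> // e e0; have [d d0 hd] := dX e e0.
by exists d => // s Js; apply: hd; exact: JJ.
Qed.

Section OnSegment.
Variables (T : R) (P : E -> E) (X : R -> E -> E).
Hypothesis solX : riccati_solution A D S `[0, T] P X.

Lemma solution_sym t : 0 <= t -> t <= T -> sym_op (X t).
Proof.
move=> t0 tT; have /riccati_solutionP[_ h] := solX.
by have [] := h t (iffRL (in_seg T t) (conj t0 tT)).
Qed.

Lemma solution_deriv t : 0 <= t -> t <= T -> op_deriv `[0, T] X t (rhs (X t)).
Proof.
move=> t0 tT; have /riccati_solutionP[_ h] := solX.
by have [] := h t (iffRL (in_seg T t) (conj t0 tT)).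
Qed.

Lemma solution_form t : 0 <= t -> t <= T ->
  form_deriv T X t (ric_form A D S (X t)).
Proof.
move=> t0 tT e e0; have [d d0 hd] := op_deriv_form (solution_deriv t0 tT) e0.
exists d => // s s0 sT sd x; have := hd s s0 sT sd x.
by rewrite riccati_rhs_form //; exact: solution_sym.
Qed.

Lemma solution_subsolution : subsolution A D S T X.
Proof.
move=> t t0 tT; split; first exact: solution_sym.
by exists (ric_form A D S (X t)) => //; exact: solution_form.
Qed.

Lemma solution_supersolution : supersolution A D S T X.
Proof.
move=> t t0 tT; split; first exact: solution_sym.
by exists (ric_form A D S (X t)) => //; exact: solution_form.
Qed.

(** Local bounds come from differentiability; real induction makes them
    uniform on the segment. *)
Lemma solution_bounded :
  exists2 B, 0 <= B & forall t, 0 <= t -> t <= T -> nbd (X t) B.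
Proof.
have loc t : 0 <= t -> t <= T -> exists2 d, 0 < d & exists2 B, 0 <= B &
    forall s, 0 <= s -> s <= T -> `|s - t| < d -> nbd (X s) B.
  move=> t0 tT; have sX := solution_sym t0 tT.
  have [c c0 hc] := sym_bd sX; have [v v0 hv] := sym_bd (sym_rhs sX).
  have [d d0 hd] := solution_deriv t0 tT ltr01.
  exists (Num.min 1 d); first by rewrite lt_min ltr01.
  exists (1 + v + c); first by rewrite !addr_ge0.
  move=> s s0 sT; rewrite lt_min => /andP[s1 sd] x.
  have sJ : `[0, T]%classic s by apply/in_seg.
  have := hd s sJ sd x; rewrite mul1r !fctE => h.
  have -> : X s x = (X s x - X t x - scale_op (s - t) (rhs (X t)) x)
      + scale_op (s - t) (rhs (X t)) x + X t x by rewrite !subrK.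
  apply: le_trans (nrD _ _) _; rewrite mulrDl lerD //.
  apply: le_trans (nrD _ _) _; rewrite mulrDl lerD //.
    by apply: le_trans h _; rewrite ler_wpM2r ?nr_ge0 // ltW.
  rewrite [nr _]nrZ -[v]mul1r -mulrA; apply: ler_pM => //; first exact: nr_ge0.
  exact: ltW.
have [T0|T0] := leP 0 T; last first.
  by exists 0 => // t t0 tT; have := le_lt_trans (le_trans t0 tT) T0; rewrite ltxx.
suff : forall t, 0 <= t -> t <= T -> exists2 B, 0 <= B &
    forall s, 0 <= s -> s <= t -> nbd (X s) B.
  by move=> /(_ T T0 (lexx T)) [B B0 h]; exists B.
apply: real_induction.
- have [d d0 [B B0 h]] := loc 0 (lexx 0) T0; exists B => // s s0 s0'.
  have -> : s = 0 by apply/le_anti; rewrite s0 s0'.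
  by apply: h => //; rewrite subrr normr0.
- move=> t t0 tT [B1 B10 h1]; have [d d0 [B2 B20 h2]] := loc t t0 (ltW tT).
  exists d => // s ts sT sd; exists (Num.max B1 B2); first by rewrite le_max B10.
  move=> u u0 us; have [ut|ut] := leP u t.
    by apply: (nbdW _ (h1 u u0 ut)); rewrite le_max lexx.
  apply: (nbdW _ (h2 u u0 (le_trans us sT) _)); first by rewrite le_max lexx orbT.
  by rewrite gtr0_norm; lra.
- move=> t t0 tT h; have [d d0 [B2 B20 h2]] := loc t (ltW t0) tT.
  pose v := Num.max 0 (t - d / 2).
  have v0 : 0 <= v by rewrite le_max lexx.
  have vt : v < t by rewrite gt_max t0 /=; lra.
  have dv : t - d / 2 <= v by rewrite le_max lexx orbT.
  have [B1 B10 h1] := h v v0 vt.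
  exists (Num.max B1 B2); first by rewrite le_max B10.
  move=> u u0 ut; have [uv|uv] := leP u v.
    by apply: (nbdW _ (h1 u u0 uv)); rewrite le_max lexx.
  apply: (nbdW _ (h2 u u0 (le_trans ut tT) _)); first by rewrite le_max lexx orbT.
  by rewrite ler0_norm; lra.
Qed.

End OnSegment.

Lemma solution_le T P1 P2 X1 X2 :
  riccati_solution A D S `[0, T] P1 X1 -> riccati_solution A D S `[0, T] P2 X2 ->
  (forall x, ip (P1 x) x <= ip (P2 x) x) ->
  forall t, 0 <= t -> t <= T -> forall x, ip (X1 t x) x <= ip (X2 t x) x.
Proof.
move=> s1 s2 h.
have [B1 B10 b1] := solution_bounded s1; have [B2 B20 b2] := solution_bounded s2.
apply: (comparison bA sS (solution_subsolution s1) (solution_supersolution s2)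
  (B := Num.max B1 B2)); first by rewrite le_max B10.
  move=> t t0 tT; split; first by apply: (nbdW _ (b1 t t0 tT)); rewrite le_max lexx.
  by apply: (nbdW _ (b2 t t0 tT)); rewrite le_max lexx orbT.
by move=> x; rewrite s1.1 s2.1.
Qed.

Lemma solution_unique T P X1 X2 :
  riccati_solution A D S `[0, T] P X1 -> riccati_solution A D S `[0, T] P X2 ->
  forall t, 0 <= t -> t <= T -> X1 t = X2 t.
Proof.
move=> s1 s2 t t0 tT.
have y1 := solution_sym s1 t0 tT; have y2 := solution_sym s2 t0 tT.
apply: le_op_anti => //; apply/le_opP => // x.
  exact: (solution_le s1 s2).
exact: (solution_le s2 s1).
Qed.

Lemma ric_form_scalar c x : ric_form A D S (scalar_op c) x =
  c * (2 * ip (A x) x) + ip (D x) x - c ^+ 2 * ip (S x) x.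
Proof.
rewrite /ric_form /scalar_op /scale_op !fctE (linZ _ _ (sym_lin sS)) !ipZl ipZr.
by rewrite (ipC x); ring.
Qed.

Lemma nbd_scalar c : nbd (@scalar_op R k E c) `|c|.
Proof. by move=> x; rewrite [nr _]nrZ. Qed.

Lemma solution_le_scalar T P X c :
  riccati_solution A D S `[0, T] P X ->
  (forall x, ric_form A D S (scalar_op c) x <= 0) ->
  (forall x, ip (P x) x <= c * ip x x) ->
  forall t, 0 <= t -> t <= T -> forall x, ip (X t x) x <= c * ip x x.
Proof.
move=> sX hc hP t t0 tT x; have [B B0 hB] := solution_bounded sX.
have sup : supersolution A D S T (fun=> scalar_op c).
  move=> s s0 sT; split; first exact: sym_scalar.
  by exists (fun=> 0) => //; exact: form_deriv_cst.
rewrite -ip_scalar_op.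
move: t t0 tT x; apply: (comparison bA sS (solution_subsolution sX) sup
  (B := Num.max B `|c|)); first by rewrite le_max B0.
  move=> t t0 tT; split; first by apply: (nbdW _ (hB t t0 tT)); rewrite le_max lexx.
  by apply: (nbdW _ (@nbd_scalar c)); rewrite le_max lexx orbT.
by move=> x; rewrite sX.1 ip_scalar_op.
Qed.

Lemma solution_ge_scalar T P X c :
  riccati_solution A D S `[0, T] P X ->
  (forall x, 0 <= ric_form A D S (scalar_op c) x) ->
  (forall x, c * ip x x <= ip (P x) x) ->
  forall t, 0 <= t -> t <= T -> forall x, c * ip x x <= ip (X t x) x.
Proof.
move=> sX hc hP t t0 tT x; have [B B0 hB] := solution_bounded sX.
have sub : subsolution A D S T (fun=> scalar_op c).
  move=> s s0 sT; split; first exact: sym_scalar.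
  by exists (fun=> 0) => //; exact: form_deriv_cst.
rewrite -ip_scalar_op.
move: t t0 tT x; apply: (comparison bA sS sub (solution_supersolution sX)
  (B := Num.max B `|c|)); first by rewrite le_max B0.
  move=> t t0 tT; split; last by apply: (nbdW _ (hB t t0 tT)); rewrite le_max lexx.
  by apply: (nbdW _ (@nbd_scalar c)); rewrite le_max lexx orbT.
by move=> x; rewrite sX.1 ip_scalar_op.
Qed.

Lemma is_derive_factor (a r t : R) :
  is_derive t 1 (fun s => expR (- (r * expR (- (a * s)))))
    (a * (r * expR (- (a * t))) * expR (- (r * expR (- (a * t))))).
Proof.
have d1 : is_derive t 1 (fun s : R => - (a * s)) (- a).
  have -> : (fun s : R => - (a * s)) = (fun s => (- a) *: s).
    by apply/funext => s; rewrite /GRing.scale /= mulNr.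
  apply: is_derive_eq; rewrite /GRing.scale /= mulr1 //.
have d2 : is_derive t 1 (fun s => expR (- (a * s))) (- a * expR (- (a * t))).
  rewrite mulrC.
  exact: (@is_derive1_comp _ expR (fun s : R => - (a * s)) t _ _ (is_derive_expR _) d1).
have d3 : is_derive t 1 (fun s => - (r * expR (- (a * s))))
   (a * (r * expR (- (a * t)))).
  have -> : (fun s => - (r * expR (- (a * s)))) = (fun s => (- r) *: expR (- (a * s))).
    by apply/funext => s; rewrite /GRing.scale /= mulNr.
  by apply: is_derive_eq; rewrite /GRing.scale /=; ring.
rewrite mulrC.
exact: (@is_derive1_comp _ expR (fun s : R => - (r * expR (- (a * s)))) t _ _
  (is_derive_expR _) d3).
Qed.

(** With [u = exp(- r exp(- alpha t))], the curve [u X1] is a subsolution: the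
    inequalities [u rho <= 1 - u <= rho] for [u = exp(- rho)] turn
    [alpha lambda = mD - cS lambda^2] into the required bound. *)
Lemma solution_contraction T P1 P2 X1 X2 mD cS lambda alpha r :
  riccati_solution A D S `[0, T] P1 X1 -> riccati_solution A D S `[0, T] P2 X2 ->
  0 <= lambda -> 0 <= r -> 0 <= mD -> 0 <= cS -> 0 <= alpha ->
  alpha * lambda = mD - cS * lambda ^+ 2 ->
  (forall x, mD * ip x x <= ip (D x) x) ->
  (forall x, - cS * ip x x <= ip (S x) x) ->
  (forall t, 0 <= t -> t <= T -> forall x, 0 <= ip (X1 t x) x <= lambda * ip x x) ->
  (forall x, ip (P1 x) x <= expR r * ip (P2 x) x) ->
  forall t, 0 <= t -> t <= T -> forall x,
    ip (X1 t x) x <= expR (r * expR (- (alpha * t))) * ip (X2 t x) x.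
Proof.
move=> s1 s2 l0 r0 m0 cS0 al0 hal hD hS h1 hP t t0 tT x.
have [B2 B20 b2] := solution_bounded s2.
pose rho s := r * expR (- (alpha * s)).
pose u s := expR (- rho s).
have rho0 s : 0 <= rho s by rewrite mulr_ge0 ?expR_ge0.
have u0 s : 0 < u s by exact: expR_gt0.
have u1 s : u s <= 1 by rewrite -expR0 ler_expR oppr_le0.
have b1 s : 0 <= s -> s <= T -> nbd (X1 s) lambda.
  move=> s0 sT; apply: sym_nbd; first exact: (solution_sym s1).
  by move=> y; have /andP[? ?] := h1 s s0 sT y; rewrite ger0_norm.
have sub : subsolution A D S T (fun s => scale_op (u s) (X1 s)).
  move=> s s0 sT; have sX := solution_sym s1 s0 sT; split; first exact: symZ.
  have [v v0 hv] := sym_bd (sym_rhs sX).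
  exists (fun y => alpha * rho s * u s * ip (X1 s y) y + u s * ric_form A D S (X1 s) y).
    apply: (@form_deriv_scale _ _ _ _ _ _ v lambda) => //.
    - by move=> y; rewrite -riccati_rhs_form //; exact: nbd_ip_norm.
    - by move=> y; exact: nbd_ip_norm (b1 s s0 sT).
    - exact: (deriv_eps (is_derive_factor alpha r s)).
    - exact: (solution_form s1).
  move=> y; rewrite /ric_form /scale_op !fctE (linZ _ _ (sym_lin sS)) !ipZl ipZr.
  have /andP[q0 q1] := h1 s s0 sT y.
  have N0 := ip_ge0 y.
  have hy : ip (X1 s y) (X1 s y) <= lambda ^+ 2 * ip y y.
    by rewrite -!nr_sqr -exprMn lerXn2r ?nnegrE ?mulr_ge0 ?nr_ge0 // b1.
  have hSy := hS (X1 s y); have hDy := hD y.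
  have ur : u s * (1 + rho s) <= 1.
    have : u s * (1 + rho s) <= u s * expR (rho s) by rewrite ler_pM2l // expR_ge1Dx.
    by rewrite /u -expRD addNr expR0.
  have ru : 1 - rho s <= u s by rewrite /u; apply: expR_ge1Dx.
  have us := u0 s; have us1 := u1 s; have rs := rho0 s.
  move: (u s) (rho s) us us1 rs ur ru => w p w0 w1 p0 wp pw.
  move: q0 q1 N0 hy hSy hDy.
  move: (ip (X1 s y) (X1 s y)) (ip (S (X1 s y)) (X1 s y)) (ip (D y) y)
    (ip y y) (ip (X1 s y) y) => Y SY DY N q q0 q1 N0 hy hSy hDy.
  have k1 : alpha * p * w * q <= w * p * (mD - cS * lambda ^+ 2) * N.
    have : alpha * p * w * q <= alpha * p * w * (lambda * N).
      by rewrite ler_wpM2l // !mulr_ge0 // ltW.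
    rewrite -hal; lra.
  have k2 : (1 - w) * (mD * N) <= (1 - w) * DY by rewrite ler_wpM2l //; lra.
  have k3 : w * (1 - w) * (- cS * (lambda ^+ 2 * N)) <= w * (1 - w) * SY.
    rewrite ler_wpM2l ?mulr_ge0 //; [exact: ltW|lra|].
    apply: le_trans hSy; rewrite !mulNr lerN2 ler_wpM2l //.
  have k4 : 0 <= mD * N * (1 - w * (1 + p)) by rewrite !mulr_ge0 //; lra.
  have k5 : 0 <= cS * lambda ^+ 2 * N * (w * (p - (1 - w))).
    by rewrite !mulr_ge0 ?sqr_ge0 //; lra.
  lra.
suff : ip (scale_op (u t) (X1 t) x) x <= ip (X2 t x) x.
  rewrite ip_scale_op /u -/(rho t) expRN ler_pdivrMl ?expR_gt0 //.
apply: (comparison bA sS sub (solution_supersolution s2)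
  (B := Num.max lambda B2)) t0 tT x; first by rewrite le_max l0.
  move=> s s0 sT; split.
    apply: (nbdW _ (nbdZ (u s) (b1 s s0 sT))); rewrite le_max gtr0_norm //.
    by rewrite ler_piMl.
  by apply: (nbdW _ (b2 s s0 sT)); rewrite le_max lexx orbT.
move=> x; rewrite ip_scale_op s1.1 s2.1 /u /rho mulr0 oppr0 expR0 mulr1 expRN.
by rewrite ler_pdivrMl ?expR_gt0.
Qed.

End Solutions.
(** * Limits of symmetric operators *)

Section OperatorLimits.
Context {R : realType} {k : scalar_kind} {E : hilbert_space R k}.
Implicit Types (x y z : E) (r c t s : R) (P Q : E -> E).
Local Notation "r %:K" := (scalar_of k r) (at level 2, format "r %:K").

Lemma half_exp_le (N : nat) : (1 / 2 : R) ^+ N <= N.+1%:R^-1.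
Proof.
elim: N => [|N IH]; first by rewrite expr0 invr1.
have N0 : 0 < N.+1%:R :> R by rewrite ltr0n.
have N1 : 0 < N.+2%:R :> R by rewrite ltr0n.
rewrite exprS -[leRHS]mul1r ler_pdivlMr //.
apply: (@le_trans _ _ (1 / 2 * N.+1%:R^-1 * N.+2%:R)).
  by apply: ler_wpM2r; [exact: ltW|rewrite ler_pM2l // divr_gt0].
rewrite -[N.+2%:R](natrD _ 1 N.+1) mulrDr mulr1 mulfVK ?gt_eqF //.
have : N.+1%:R^-1 <= 1 :> R by rewrite invf_le1 // ler1n.
by move: (N.+1%:R^-1) => i; lra.
Qed.

Lemma half_exp_small (C e : R) : 0 <= C -> 0 < e ->
  exists N, forall n, (N <= n)%N -> C * (1 / 2) ^+ n <= e.
Proof.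
move=> C0 e0; exists (Num.bound (C / e)) => n Nn.
have := archi_boundP (divr_ge0 C0 (ltW e0)); rewrite ltr_pdivrMr // => h.
have n0 : 0 < n.+1%:R :> R by rewrite ltr0n.
apply: le_trans (ler_wpM2l C0 (half_exp_le n)) _.
rewrite ler_pdivrMr //; apply: le_trans (ltW h) _; rewrite mulrC ler_pM2l //.
by rewrite ler_nat ltnW.
Qed.

Lemma le_half_exp (a b C : R) :
  0 <= C -> (forall N, a <= b + C * (1 / 2) ^+ N) -> a <= b.
Proof.
move=> C0 h; apply/ler_addgt0Pr => e e0.
have [N hN] := half_exp_small C0 e0.
by apply: le_trans (h N) _; rewrite lerD2l; exact: hN.
Qed.

Definition op_cvg (U : nat -> E -> E) P :=
  forall e, 0 < e -> exists N, forall n, (N <= n)%N -> nbd (U n - P) e.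

Lemma nrZK (a : scalar_field R k) x : nr (a *: x) = re_of `|a| * nr x.
Proof.
by rewrite /nr normrZ -{1}(ge0_scalar_ofK (normr_ge0 a)) re_ofZ.
Qed.

Lemma sym_closed P :
  (forall e, 0 < e -> exists2 Q, sym_op Q & nbd (P - Q) e) -> sym_op P.
Proof.
move=> h; apply/sym_opP.
have small (u : R) (c : R) : 0 <= c -> (forall e, 0 < e -> u <= e * c) -> u <= 0.
  move=> c0 hu; have := @ge0_limit _ (- u) c c0 _; rewrite oppr_ge0; apply.
  by move=> e e0; have := hu e e0; lra.
split.
- move=> a x y; apply/eqP; rewrite -subr_eq0; apply/eqP/nr_eq0/le_anti.
  rewrite nr_ge0 andbT.
  have ra : 0 <= re_of `|a|.
    by rewrite -(@le_scalar_of _ k) (ge0_scalar_ofK (normr_ge0 a)) rmorph0.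
  apply: (small _ (nr (a *: x + y) + re_of `|a| * nr x + nr y)).
    by rewrite !addr_ge0 ?mulr_ge0 ?nr_ge0.
  move=> e e0; have [Q sQ hQ] := h e e0.
  have -> : P (a *: x + y) - (a *: P x + P y) =
    (P - Q) (a *: x + y) - a *: (P - Q) x - (P - Q) y.
    rewrite !fctE (sym_lin sQ) scalerBr -[RHS]addrA -[in RHS]opprD [in RHS]addrACA.
    by rewrite -[in RHS]opprD opprB addrA subrK.
  apply: le_trans (nrB _ _) _; rewrite mulrDr lerD //.
  apply: le_trans (nrB _ _) _; rewrite mulrDr lerD //.
  by rewrite nrZK mulrCA ler_wpM2l.
- have [Q sQ hQ] := h 1 ltr01; have [c c0 hc] := sym_bd sQ.
  exists (1 + c); first by rewrite addr_ge0.
  have -> : P = (P - Q) + Q by rewrite subrK.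
  exact: nbdD.
- move=> x y; apply/eqP; rewrite -subr_eq0 -normr_le0.
  apply: (small _ (nr x * nr y + nr x * nr y)); first by rewrite addr_ge0 ?mulr_ge0 ?nr_ge0.
  move=> e e0; have [Q sQ hQ] := h e e0.
  have -> : ip (P x) y - ip x (P y) = ip ((P - Q) x) y - ip x ((P - Q) y).
    by rewrite !fctE !ipBl !ipBr (sym_ip x y sQ); ring.
  apply: le_trans (ler_normB _ _) _; rewrite mulrDr lerD //.
    apply: le_trans (ip_norm_le _ _) _; rewrite mulrA ler_wpM2r ?nr_ge0 //.
  by apply: le_trans (ip_norm_le _ _) _; rewrite mulrCA ler_wpM2l ?nr_ge0.
Qed.

Lemma op_complete (U : nat -> E -> E) : (forall n, sym_op (U n)) ->
  (forall e, 0 < e -> exists N, forall m n, (N <= m)%N -> (N <= n)%N ->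
     nbd (U m - U n) e) ->
  exists2 P, sym_op P & op_cvg U P.
Proof.
move=> sU cU.
have /choice[P hP] : forall x, exists l, nr_cvg (fun n => U n x) l.
  move=> x; apply: nr_complete => e e0.
  have n1 : 0 < nr x + 1 by rewrite ltr_wpDl ?nr_ge0.
  have [N hN] := cU (e / (nr x + 1)) (divr_gt0 e0 n1).
  exists N => m n Nm Nn; apply: le_trans (hN m n Nm Nn x) _.
  rewrite mulrAC ler_pdivrMr // ler_pM2l // lerDl //.
have cP : op_cvg U P.
  move=> e e0; have [N hN] := cU e e0; exists N => n Nn x.
  apply/ler_addgt0Pr => e' e'0; have [M hM] := hP x e' e'0.
  have := hM (maxn M N) (leq_maxl _ _); have := hN n (maxn M N) Nn (leq_maxr _ _) x.
  rewrite !fctE; set u := U (maxn _ _) x => h1 h2.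
  have -> : U n x - P x = (U n x - u) + (u - P x) by rewrite addrA subrK.
  by apply: le_trans (nrD _ _) _; rewrite lerD.
exists P => //; apply: sym_closed => e e0; have [N hN] := cP e e0.
by exists (U N) => // x; have := hN N (leqnn N) x; rewrite !fctE nrBC.
Qed.

Lemma op_cvg_le (U : nat -> E -> E) P Q c : op_cvg U P ->
  (exists N, forall n, (N <= n)%N -> nbd (U n - Q) c) -> nbd (P - Q) c.
Proof.
move=> cU [N hN] x; apply/ler_addgt0Pr => e e0.
have n1 : 0 < nr x + 1 by rewrite ltr_wpDl ?nr_ge0.
have [M hM] := cU (e / (nr x + 1)) (divr_gt0 e0 n1).
have := hM (maxn M N) (leq_maxl _ _) x; have := hN (maxn M N) (leq_maxr _ _) x.
rewrite !fctE; set u := U (maxn _ _) x => h1 h2.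
have -> : P x - Q x = (u - Q x) - (u - P x) by rewrite opprB [RHS]addrC addrA subrK.
apply: le_trans (nrB _ _) _; rewrite lerD //.
apply: le_trans h2 _; rewrite mulrAC ler_pdivrMr // ler_pM2l // lerDl //.
Qed.

Lemma sym_sum I (l : seq I) (F : I -> E -> E) :
  (forall i, sym_op (F i)) -> sym_op (\sum_(i <- l) F i).
Proof. by move=> h; elim/big_ind: _ => // [|P Q]; [exact: sym0|exact: symD]. Qed.

Lemma half_geometric N :
  \sum_(n < N) (1 / 2 : R) ^+ n = 2 - 2 * (1 / 2) ^+ N.
Proof.
elim: N => [|N IH]; first by rewrite big_ord0 expr0; ring.
by rewrite big_ord_recr IH /= exprS; lra.
Qed.

Lemma sum_triangle (V : zmodType) (F : nat -> nat -> V) N :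
  \sum_(n < N) \sum_(i < n.+1) F i (n - i)%N
  = \sum_(i < N) \sum_(j < N - i) F i j.
Proof.
elim: N => [|N IH]; first by rewrite !big_ord0.
rewrite big_ord_recr IH /= [in RHS]big_ord_recr /= subSn // subnn big_ord1.
rewrite big_ord_recr /= subnn addrA -big_split /=; congr (_ + _).
by apply: eq_bigr => i _; rewrite subSn ?big_ord_recr // ltnW.
Qed.

End OperatorLimits.
(** * Local existence by power series *)

Section PowerSeries.
Context {R : realType} {k : scalar_kind} {E : hilbert_space R k}.
Implicit Types (x y z : E) (r c t s : R) (P Q : E -> E).
Local Notation "r %:K" := (scalar_of k r) (at level 2, format "r %:K").

Lemma scale_opE c P x : scale_op c P x = c%:K *: P x.
Proof. by []. Qed.

Lemma fun_sumE I (l : seq I) (F : I -> E -> E) x :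
  (\sum_(i <- l) F i) x = \sum_(i <- l) F i x.
Proof. by elim/big_rec2: _ => // i a b _ <-. Qed.

(** Taylor's formula to second order on [[-h, h]]. The constant [4 ^ n] is crude
    but geometric, so that a smaller radius [h] absorbs it. *)
Lemma exp_taylor (h s t : R) n : 0 <= h -> `|s| <= h -> `|t| <= h ->
  h ^+ 2 * `|s ^+ n - t ^+ n - (s - t) * (n%:R * t ^+ n.-1)|
    <= 4 ^+ n * h ^+ n * `|s - t| ^+ 2.
Proof.
move=> h0 sh th; elim: n => [|n IH].
  by rewrite !expr0 subrr mul0r mulr0 subrr normr0 mulr0 !mul1r sqr_ge0.
have -> : s ^+ n.+1 - t ^+ n.+1 - (s - t) * (n.+1%:R * t ^+ n.+1.-1) =
  s * (s ^+ n - t ^+ n - (s - t) * (n%:R * t ^+ n.-1))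
  + n%:R * t ^+ n.-1 * (s - t) ^+ 2.
  rewrite -[n.+1.-1]/n -(natr1 n).
  by case: n {IH} => [|n]; rewrite ?expr0 /= ?exprS; ring.
set u := s ^+ n - _ - _ in IH *; set d := `|s - t| in IH *.
have d0 : 0 <= d ^+ 2 by exact: sqr_ge0.
apply: (@le_trans _ _ (h * (h ^+ 2 * `|u|) + n%:R * h ^+ n.+1 * d ^+ 2)).
  apply: le_trans (ler_wpM2l (sqr_ge0 h) (ler_normD _ _)) _.
  rewrite mulrDr; apply: lerD.
    by rewrite normrM mulrCA; apply: ler_wpM2r => //; rewrite mulr_ge0 ?sqr_ge0.
  rewrite !normrM normr_nat !normrX -/d.
  have -> : h ^+ 2 * (n%:R * `|t| ^+ n.-1 * d ^+ 2) =
    n%:R * (h ^+ 2 * `|t| ^+ n.-1) * d ^+ 2 by ring.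
  apply: ler_wpM2r => //; case: n {IH u} => [|n]; first by rewrite !mul0r.
  rewrite ler_pM2l ?ltr0n // -[n.+1.-1]/n -[n.+2]/(2 + n)%N exprD.
  by rewrite ler_wpM2l ?sqr_ge0 // lerXn2r ?nnegrE.
have n4 : n%:R <= 4 ^+ n :> R.
  by rewrite -natrX ler_nat ltnW // ltn_expl.
have hn : 0 <= h ^+ n.+1 * d ^+ 2 by rewrite mulr_ge0 // exprn_ge0.
have := ler_wpM2l h0 IH; have := ler_wpM2r hn n4.
have p4 : 0 <= 4 ^+ n * (h ^+ n.+1 * d ^+ 2) by rewrite mulr_ge0 // exprn_ge0.
rewrite !exprS in p4 *; lra.
Qed.

Variables A D S : E -> E.
Hypothesis bA : bounded_op A.
Hypothesis bA' : bounded_op (adjoint A).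
Hypothesis adjA : forall x y, ip (A x) y = ip x (adjoint A y).
Hypothesis sD : sym_op D.
Hypothesis sS : sym_op S.
Local Notation A' := (adjoint A).
Local Notation rhs := (riccati_rhs A D S).

Definition cauchy_product (X : nat -> E -> E) n :=
  \sum_(i < n.+1) (X i \o S \o X (n - i)%N).

(** The coefficient of [t ^ n.+1] forced by those up to [n] when
    [sum_n X n t ^ n] solves the Riccati equation. *)
Definition next_coef (X : nat -> E -> E) n :=
  scale_op n.+1%:R^-1 ((A' \o X n) + (X n \o A) + (if n == 0%N then D else 0)
    - cauchy_product X n).

(** Course-of-values recursion: [coef_table P n] holds the coefficients up to
    index [n]. *)
Fixpoint coef_table P n m : E -> E :=
  if n is n'.+1 then
    if (m <= n')%N then coef_table P n' m else next_coef (coef_table P n') n'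
  else P.

Definition coef P n := coef_table P n n.

Lemma coef_tableE P n m : (m <= n)%N -> coef_table P n m = coef P m.
Proof.
elim: n => [|n IH] mn; first by move: mn; rewrite leqn0 => /eqP ->.
rewrite /=; case: (leqP m n) => [/IH //|nm].
have -> : m = n.+1 by apply/eqP; rewrite eqn_leq mn.
by rewrite /coef /= ltnn.
Qed.

Lemma coefS P n : coef P n.+1 = next_coef (coef P) n.
Proof.
rewrite /coef /= ltnn /next_coef /cauchy_product coef_tableE //.
congr (scale_op _ (_ - _)); apply: eq_bigr => i _.
by rewrite !coef_tableE ?leq_subr // -ltnS.
Qed.

Lemma sym_cauchy_product X n : (forall m, (m <= n)%N -> sym_op (X m)) ->
  sym_op (cauchy_product X n).
Proof.
move=> sX.
have -> : cauchy_product X n = scale_op (1 / 2)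
    (\sum_(i < n.+1) ((X i \o S \o X (n - i)%N) + (X (n - i)%N \o S \o X i))).
  rewrite big_split /=.
  rewrite [X in _ + X](_ : _ = cauchy_product X n); last first.
    rewrite /cauchy_product (reindex_inj rev_ord_inj) /=; apply: eq_bigr => i _.
    by rewrite subSS subKn // -ltnS.
  by rewrite scale_half.
apply: symZ; apply: sym_sum => i.
by apply: sym_sandwich => //; apply: sX; rewrite ?leq_subr // -ltnS.
Qed.

Lemma sym_coef P n : sym_op P -> sym_op (coef P n).
Proof.
move=> sP; elim/ltn_ind: n => -[//|n] IH; rewrite coefS; apply: symZ.
apply: symB; last first.
  by apply: sym_cauchy_product => m mn; apply: IH; rewrite ltnS.
apply: symD; first by apply: sym_lyapunov => //; exact: IH.
by case: eqP => // _; exact: sym0.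
Qed.

(* [hrho] closes the induction for the majorant [b rho ^ n] of the coefficients;
   [hh] leaves room for the factor [4 ^ n] of [exp_taylor]. *)
Variables a dd c b rho h : R.
Hypotheses (nA : nbd A a) (nA' : nbd A' a) (nD : nbd D dd) (nS : nbd S c).
Hypotheses (a0 : 0 <= a) (dd0 : 0 <= dd) (c0 : 0 <= c) (b0 : 0 < b).
Hypotheses (rho1 : 1 <= rho) (h0 : 0 < h).
Hypothesis hrho : 2 * a * b + dd + c * b ^+ 2 <= b * rho.
Hypothesis hh : h * rho <= 1 / 8.

Let rho0 : 0 < rho. Proof. exact: lt_le_trans ltr01 rho1. Qed.

(** The Cauchy product of the majorants [b rho ^ n] has [n + 1] equal terms,
    which the factor [1 / (n + 1)] of [next_coef] cancels. *)
Lemma nbd_coef P n : nbd P b -> nbd (coef P n) (b * rho ^+ n).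
Proof.
have b0' := b0.
move=> nP; elim/ltn_ind: n => -[_|n IH]; first by rewrite expr0 mulr1.
have rn : 1 <= rho ^+ n by rewrite exprn_ege1.
have bn : 0 <= b * rho ^+ n by rewrite mulr_ge0 //; lra.
have IHn := IH n (ltnSn n).
have conv : nbd (cauchy_product (coef P) n) (n.+1%:R * (c * b ^+ 2 * rho ^+ n)).
  rewrite mulr_natl -[in X in _ *+ X](card_ord n.+1) -sumr_const.
  apply: nbd_sum => i.
  have -> : c * b ^+ 2 * rho ^+ n = b * rho ^+ i * c * (b * rho ^+ (n - i)).
    have -> : rho ^+ n = rho ^+ i * rho ^+ (n - i).
      by rewrite -exprD subnKC // -ltnS.
    by ring.
  have bi j : 0 <= b * rho ^+ j by rewrite mulr_ge0 ?exprn_ge0 ?ltW.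
  have i1 : (i < n.+1)%N by [].
  have i2 : (n - i < n.+1)%N by rewrite ltnS leq_subr.
  apply: nbd_comp; [by rewrite mulr_ge0| |exact: IH].
  by apply: nbd_comp => //; exact: IH.
have nD' : nbd (if n == 0%N then D else 0) (dd * rho ^+ n).
  case: eqP => _; first by apply: nbdW nD; rewrite ler_peMr.
  by move=> x; rewrite [nr _]nr0 !mulr_ge0 ?nr_ge0 ?exprn_ge0 // ltW.
have n1 : 1 <= n.+1%:R :> R by rewrite ler1n.
have n0 : 0 < n.+1%:R :> R by rewrite ltr0n.
rewrite coefS; apply: nbdW (nbdZ _ (nbdD (nbdD (nbdD (nbd_comp a0 nA' IHn)
  (nbd_comp bn IHn nA)) nD') (nbdN conv))).
rewrite gtr0_norm ?invr_gt0 // ler_pdivrMl // (exprS rho n).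
have e1 : 0 <= a * (b * rho ^+ n) by rewrite mulr_ge0.
have e2 : 0 <= dd * rho ^+ n by rewrite mulr_ge0 //; lra.
have := ler_wpM2r (le_trans ler01 rn) hrho.
have m1 : 0 <= (n.+1%:R - 1) * (2 * (a * (b * rho ^+ n)) + dd * rho ^+ n).
  by rewrite mulr_ge0 //; lra.
move=> /(ler_wpM2l (ltW n0)); move: (n.+1%:R) m1 => m m1 n1'; lra.
Qed.

Variable P0 : E -> E.
Hypotheses (sP0 : sym_op P0) (nP0 : nbd P0 b).
Local Notation X := (coef P0).

Definition partial_sum N t := \sum_(n < N) scale_op (t ^+ n) (X n).
Definition partial_sum_deriv N t :=
  \sum_(n < N) scale_op (n%:R * t ^+ n.-1) (X n).
Local Notation psum := partial_sum.
Local Notation dpsum := partial_sum_deriv.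

Lemma sym_psum N t : sym_op (psum N t).
Proof. by apply: sym_sum => i; apply: symZ; exact: sym_coef. Qed.

Lemma nbd_term n t : `|t| <= h -> nbd (scale_op (t ^+ n) (X n)) (b * (1 / 8) ^+ n).
Proof.
have rho0' := rho0.
move=> th; apply: nbdW (nbdZ _ (nbd_coef n nP0)).
rewrite normrX mulrCA -exprMn ler_pM2l // lerXn2r ?nnegrE ?mulr_ge0 //; try lra.
by apply: le_trans hh; rewrite ler_pM2r.
Qed.

Lemma half_exp_ge0 n : 0 <= (1 / 2 : R) ^+ n.
Proof. by rewrite exprn_ge0 ?divr_ge0. Qed.

Lemma eighth_le_half n : (1 / 8 : R) ^+ n <= (1 / 2) ^+ n.
Proof. by rewrite lerXn2r ?nnegrE //; lra. Qed.

Lemma nbd_psum_diff M N t : `|t| <= h -> (N <= M)%N ->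
  nbd (psum M t - psum N t) (2 * b * ((1 / 2) ^+ N - (1 / 2) ^+ M)).
Proof.
move=> th /subnKC <-; elim: (M - N)%N => [|m IH].
  by rewrite addn0 !subrr mulr0 => x; rewrite [nr _]nr0 mul0r.
rewrite addnS /psum big_ord_recr /= -/(psum _ t) addrAC.
apply: nbdW (nbdD IH (nbd_term _ th)).
have := ler_wpM2l (ltW b0) (eighth_le_half (N + m)).
rewrite exprS; lra.
Qed.

Lemma nbd_psum_tail M N t : `|t| <= h -> (N <= M)%N ->
  nbd (psum M t - psum N t) (2 * b * (1 / 2) ^+ N).
Proof.
move=> th NM; apply: nbdW (nbd_psum_diff th NM).
by rewrite ler_pM2l ?mulr_gt0 // gerBl exprn_ge0 //; lra.
Qed.

Lemma nbd_psum N t : `|t| <= h -> nbd (psum N t) (2 * b).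
Proof.
move=> th; have := nbd_psum_tail th (leq0n N).
by rewrite /psum big_ord0 subr0 expr0 mulr1.
Qed.

Lemma psum_taylor N s t : `|s| <= h -> `|t| <= h ->
  nbd (psum N s - psum N t - scale_op (s - t) (dpsum N t))
      (2 * b / h ^+ 2 * `|s - t| ^+ 2).
Proof.
move=> sh th.
have -> : psum N s - psum N t - scale_op (s - t) (dpsum N t) =
  \sum_(n < N) scale_op (s ^+ n - t ^+ n - (s - t) * (n%:R * t ^+ n.-1)) (X n).
  apply/funext => x; rewrite /psum /dpsum !fctE scale_opE !fun_sumE scaler_sumr -!sumrB.
  apply: eq_bigr => i _; rewrite !scale_opE scalerA -!scalerBl.
  by rewrite -rmorphM -!rmorphB.
have h2 : 0 < h ^+ 2 by rewrite exprn_gt0.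
have d2 : 0 <= `|s - t| ^+ 2 := sqr_ge0 _.
apply: (@nbdW _ _ _ _ (\sum_(n < N) (b / h ^+ 2 * `|s - t| ^+ 2 * (1 / 2) ^+ n))).
  rewrite -mulr_sumr half_geometric.
  have p : 0 <= b / h ^+ 2 * `|s - t| ^+ 2 * (1 / 2) ^+ N.
    by rewrite mulr_ge0 ?half_exp_ge0 // mulr_ge0 // divr_ge0 // ltW.
  lra.
apply: nbd_sum => n; apply: nbdW (nbdZ _ (nbd_coef n nP0)).
have bn : 0 <= b * rho ^+ n by rewrite mulr_ge0 ?exprn_ge0 // ltW.
rewrite -(ler_pM2l h2) [leLHS]mulrA.
apply: (le_trans (ler_wpM2r bn (exp_taylor n (ltW h0) sh th))).
have -> : 4 ^+ n * h ^+ n * `|s - t| ^+ 2 * (b * rho ^+ n) =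
   b * `|s - t| ^+ 2 * (4 * h * rho) ^+ n by rewrite !exprMn; ring.
have -> : h ^+ 2 * (b / h ^+ 2 * `|s - t| ^+ 2 * (1 / 2) ^+ n) =
  b * `|s - t| ^+ 2 * (1 / 2) ^+ n by field; rewrite gt_eqF.
apply: ler_wpM2l; first by rewrite mulr_ge0 // ltW.
have hh' := hh; rewrite lerXn2r ?nnegrE ?divr_ge0 //; last lra.
by rewrite mulr_ge0 ?mulr_ge0 // ltW.
Qed.

Lemma dpsum_rhs N t : (0 < N)%N -> `|t| <= h ->
  nbd (dpsum N.+1 t - rhs (psum N t)) (4 * b ^+ 2 * c * (1 / 2) ^+ N).
Proof.
move=> N0 th.
have linX n : linear (X n) by apply: sym_lin; exact: sym_coef.
have /bounded_opP[lA' _] := bA'; have lS := sym_lin sS.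
(* The linear parts agree; what is left are the terms of degree [i + j >= N]
   of the product [psum \o S \o psum]. *)
have -> : dpsum N.+1 t - rhs (psum N t) =
  \sum_(i < N) (scale_op (t ^+ i) (X i) \o S \o (psum N t - psum (N - i) t)).
  apply/funext => x.
  have e1 : dpsum N.+1 t x = A' (psum N t x) + psum N t (A x) + D x -
     \sum_(i < N) \sum_(j < N - i) (t ^+ i * t ^+ j)%:K *: X i (S (X j x)).
    rewrite -(sum_triangle (fun i j => (t ^+ i * t ^+ j)%:K *: X i (S (X j x)))).
    rewrite /dpsum big_ord_recl /= mul0r.
    have -> : scale_op 0 (X 0%N) = 0.
      by apply/funext => y; rewrite scale_opE rmorph0 scale0r.
    rewrite add0r /psum !fun_sumE (lin_sum _ _ lA') -big_split /=.
    have -> : D x = \sum_(n < N) (t ^+ n)%:K *: (if n == 0%N :> nat then D else 0) x.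
      case: N N0 => // N _; rewrite big_ord_recl /= big1 ?addr0.
        by rewrite expr0 rmorph1 scale1r.
      by move=> i _; rewrite scaler0.
    rewrite -big_split /= -sumrB; apply: eq_bigr => n _.
    rewrite /bump /= add1n [X n.+1]coefS /next_coef !scale_opE !fctE /= scalerA.
    rewrite -rmorphM mulrAC mulfV ?pnatr_eq0 // mul1r.
    rewrite scalerBr !scalerDr (linZ _ _ lA'); congr (_ - _).
    rewrite /cauchy_product fun_sumE scaler_sumr; apply: eq_bigr => i _ /=.
    by rewrite -exprD subnKC // -ltnS.
  rewrite !fctE /= e1 [RHS]fun_sumE.
  have -> : rhs (psum N t) x = A' (psum N t x) + psum N t (A x) + D x -
      \sum_(i < N) (t ^+ i)%:K *: X i (S (psum N t x)).
    by rewrite /riccati_rhs !fctE /= [in X in _ - X]/psum fun_sumE.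
  rewrite opprB [LHS]addrC addrA subrK -sumrB; apply: eq_bigr => i _ /=.
  rewrite !scale_opE !fctE (linB _ _ lS) (linB _ _ (linX i)) scalerBr; congr (_ - _).
  rewrite [psum (N - i) t x]fun_sumE (lin_sum _ _ lS) (lin_sum _ _ (linX i)) scaler_sumr.
  apply: eq_bigr => j _.
  by rewrite scale_opE (linZ _ _ lS) (linZ _ _ (linX i)) scalerA -rmorphM.
have cb : 0 <= 2 * b ^+ 2 * c by rewrite !mulr_ge0 // ltW.
apply: (@nbdW _ _ _ _ (\sum_(i < N) (2 * b ^+ 2 * c * (1 / 2) ^+ N * (1 / 2) ^+ i))).
  rewrite -mulr_sumr half_geometric.
  have p : 0 <= 2 * b ^+ 2 * c * (1 / 2) ^+ N * (1 / 2) ^+ N.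
    by rewrite mulr_ge0 ?half_exp_ge0 // mulr_ge0 ?half_exp_ge0.
  lra.
apply: nbd_sum => i.
have iN : (i <= N)%N by apply: ltnW.
have nt := nbd_term i th.
have be : 0 <= b * (1 / 8 : R) ^+ i by rewrite mulr_ge0 ?exprn_ge0 ?divr_ge0 // ltW.
apply: nbdW (nbd_comp _ (nbd_comp be nt nS) (nbd_psum_tail th (leq_subr i N))).
  have -> : b * (1 / 8) ^+ i * c * (2 * b * (1 / 2) ^+ (N - i)) =
    2 * b ^+ 2 * c * (1 / 2) ^+ (N - i) * (1 / 8) ^+ i by ring.
  have -> : (1 / 2 : R) ^+ N = (1 / 2) ^+ (N - i) * (1 / 2) ^+ i.
    by rewrite -exprD subnK.
  have ei : (1 / 8 : R) ^+ i <= (1 / 2) ^+ i * (1 / 2) ^+ i.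
    by rewrite -exprMn lerXn2r ?nnegrE ?mulr_ge0 ?divr_ge0 //; lra.
  by have := ler_wpM2l (mulr_ge0 cb (half_exp_ge0 (N - i))) ei; lra.
by rewrite mulr_ge0.
Qed.

Lemma rhs_lipschitz P Q B e : linear P -> 0 <= B -> 0 <= e ->
  nbd P B -> nbd Q B -> nbd (P - Q) e ->
  nbd (rhs P - rhs Q) ((2 * a + 2 * B * c) * e).
Proof.
move=> lP B0 e0 nP nQ nPQ.
have /bounded_opP[lA' _] := bA'; have lS := sym_lin sS.
have -> : rhs P - rhs Q = (A' \o (P - Q)) + ((P - Q) \o A)
    - ((P \o S \o (P - Q)) + ((P - Q) \o S \o Q)).
  apply/funext => x; rewrite /riccati_rhs !fctE /=.
  rewrite (linB _ _ lA') (linB _ _ lS) (linB _ _ lP).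
  by apply: eq_ip => z; rewrite !(ipDl, ipNl); ring.
apply: nbdW (nbdD (nbdD (nbd_comp a0 nA' nPQ) (nbd_comp e0 nPQ nA))
  (nbdN (nbdD (nbd_comp (mulr_ge0 B0 c0) (nbd_comp B0 nP nS) nPQ)
              (nbd_comp (mulr_ge0 e0 c0) (nbd_comp e0 nPQ nS) nQ)))).
lra.
Qed.

(** Passing to the limit in the second-order Taylor estimate of the partial
    sums gives differentiability and the equation at once. *)
Lemma power_series_solution : exists X, riccati_solution A D S `[0, h] P0 X.
Proof.
have b0' := b0.
have lim t : exists L, `|t| <= h -> sym_op L /\ op_cvg (fun N => psum N t) L.
  have [th|th] := boolP (`|t| <= h); last by exists P0.
  have [L sL cL] : exists2 P, sym_op P & op_cvg (fun N => psum N t) P.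
    apply: op_complete => [n|e e0]; first exact: sym_psum.
    have bb : 0 <= 2 * b by rewrite mulr_ge0 // ltW.
    have [N hN] := half_exp_small bb e0; exists N.
    move=> m n Nm Nn; case: (leqP n m) => [nm|/ltnW mn].
      by apply: nbdW (nbd_psum_tail th nm); exact: hN.
    by move=> x; rewrite !fctE nrBC; apply: nbdW (nbd_psum_tail th mn) x; exact: hN.
  by exists L.
have {lim} /choice[L hL] := lim.
have tail t N : `|t| <= h -> nbd (L t - psum N t) (2 * b * (1 / 2) ^+ N).
  move=> th; have [_ cL] := hL t th; apply: (op_cvg_le cL).
  by exists N => n Nn; exact: nbd_psum_tail.
have bL t : `|t| <= h -> nbd (L t) (2 * b).
  by move=> th; have := tail t 0%N th; rewrite /psum big_ord0 subr0 expr0 mulr1.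
have seg t : `[0, h]%classic t -> `|t| <= h.
  by move=> /in_seg[t0 th]; rewrite ger0_norm.
have z0 : `|0 : R| <= h by rewrite normr0 ltW.
exists L; apply/riccati_solutionP; split.
  apply/funext => x; apply/eqP; rewrite -subr_eq0; apply/eqP/nr_eq0/le_anti.
  rewrite nr_ge0 andbT; apply: (@le_half_exp _ _ _ (2 * b * nr x)).
    by rewrite !mulr_ge0 ?nr_ge0 // ltW.
  move=> N; rewrite add0r.
  have := tail 0 N.+1 z0 x; rewrite !fctE.
  have -> : psum N.+1 0 x = P0 x.
    rewrite /psum fun_sumE big_ord_recl big1 => [|i _].
      by rewrite addr0 scale_opE expr0 rmorph1 scale1r.
    by rewrite scale_opE /= /bump /= add1n exprS mul0r rmorph0 scale0r.
  move=> /le_trans; apply; rewrite exprS.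
  have : 0 <= 2 * b * (1 / 2) ^+ N * nr x.
    by rewrite !mulr_ge0 ?nr_ge0 ?exprn_ge0 ?ltW //; lra.
  lra.
move=> t /seg th; have [sL _] := hL t th; split=> // e e0.
pose C := 2 * b / h ^+ 2.
have C0 : 0 <= C by rewrite divr_ge0 ?mulr_ge0 ?sqr_ge0 // ltW.
have C1 : 0 < C + 1 by lra.
exists (e / (C + 1)); first by rewrite divr_gt0.
move=> s /seg sh; rewrite ltr_pdivlMr // => st x.
have /bounded_opP[lA' _] := bA'; have lS := sym_lin sS.
have linp N : linear (psum N t) by apply: sym_lin; exact: sym_psum.
pose K := 2 * b + 2 * b + `|s - t| * (4 * b ^+ 2 * c
  + (2 * a + 2 * (2 * b) * c) * (2 * b)).
have d0 := normr_ge0 (s - t).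
have b2 : 0 <= 2 * b by lra.
have K0 : 0 <= 4 * b ^+ 2 * c by rewrite !mulr_ge0 // ltW.
have K1 : 0 <= (2 * a + 2 * (2 * b) * c) * (2 * b).
  by rewrite mulr_ge0 // addr_ge0 ?mulr_ge0 // ltW.
have key N : nr ((L s - L t - scale_op (s - t) (rhs (L t))) x) <=
   C * `|s - t| ^+ 2 * nr x + K * nr x * (1 / 2) ^+ N.
  have H0 := half_exp_ge0 N.
  have -> : L s - L t - scale_op (s - t) (rhs (L t)) =
    (L s - psum N.+2 s) - (L t - psum N.+2 t)
    + (psum N.+2 s - psum N.+2 t - scale_op (s - t) (dpsum N.+2 t))
    + scale_op (s - t) (dpsum N.+2 t - rhs (psum N.+1 t))
    + scale_op (s - t) (rhs (psum N.+1 t) - rhs (L t)).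
    apply/funext => y; rewrite !fctE !scale_opE.
    by apply: eq_ip => z; rewrite !(ipZl, ipDl, ipNl); ring.
  have lip : nbd (rhs (psum N.+1 t) - rhs (L t))
     ((2 * a + 2 * (2 * b) * c) * (2 * b * (1 / 2) ^+ N.+1)).
    apply: rhs_lipschitz => //; [by rewrite mulr_ge0 // half_exp_ge0|exact: nbd_psum|exact: bL|].
    by move=> y; rewrite !fctE nrBC; exact: tail.
  have := nbdD (nbdD (nbdD (nbdD (tail s N.+2 sh) (nbdN (tail t N.+2 th)))
    (psum_taylor N.+2 sh th)) (nbdZ (s - t) (dpsum_rhs (ltn0Sn N) th)))
    (nbdZ (s - t) lip) x.
  move=> /le_trans; apply; rewrite -/C.
  have h1 : (1 / 2 : R) ^+ N.+1 <= (1 / 2) ^+ N by rewrite exprS; lra.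
  have h2 : (1 / 2 : R) ^+ N.+2 <= (1 / 2) ^+ N by rewrite 2!exprS; lra.
  have n0 := nr_ge0 x.
  have -> : C * `|s - t| ^+ 2 * nr x + K * nr x * (1 / 2) ^+ N =
    (C * `|s - t| ^+ 2 + K * (1 / 2) ^+ N) * nr x by ring.
  apply: ler_wpM2r => //.
  have j1 := ler_wpM2l b2 h2.
  have j2 := ler_wpM2l (mulr_ge0 d0 K0) h1.
  have j3 := ler_wpM2l (mulr_ge0 d0 K1) h1.
  rewrite /K; lra.
have KK : 0 <= K * nr x.
  by rewrite mulr_ge0 ?nr_ge0 // addr_ge0 ?addr_ge0 // mulr_ge0 // addr_ge0.
apply: le_trans (le_half_exp KK key) _.
rewrite expr2 mulrA ler_wpM2r ?nr_ge0 // ler_wpM2r //.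
lra.
Qed.

End PowerSeries.
(** * The Thompson metric in terms of quadratic forms *)

Section ThompsonMetric.
Context {R : realType} {k : scalar_kind} {E : hilbert_space R k}.
Implicit Types (x y z : E) (r c t s : R) (P Q : E -> E).

(** The relation [d_T(P, Q) <= r], free of infima. *)
Definition tle r P Q :=
  (forall x, ip (P x) x <= expR r * ip (Q x) x) /\
  (forall x, ip (Q x) x <= expR r * ip (P x) x).

Lemma tleC r P Q : tle r P Q -> tle r Q P.
Proof. by case. Qed.

Lemma tle_trans r s P Q U : tle r P Q -> tle s Q U -> tle (r + s) P U.
Proof.
move=> [h1 h2] [h3 h4]; split=> x; rewrite expRD.
  by apply: le_trans (h1 x) _; rewrite -mulrA ler_wpM2l ?expR_ge0.
by apply: le_trans (h4 x) _; rewrite [expR r * _]mulrC -mulrA ler_wpM2l ?expR_ge0.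
Qed.

Lemma tle_weak r s P Q : (forall x, 0 <= ip (P x) x) -> (forall x, 0 <= ip (Q x) x) ->
  r <= s -> tle r P Q -> tle s P Q.
Proof.
move=> hP hQ rs [h1 h2]; split=> x.
  by apply: le_trans (h1 x) _; rewrite ler_wpM2r // ler_expR.
by apply: le_trans (h2 x) _; rewrite ler_wpM2r // ler_expR.
Qed.

Lemma expR_sub1_le r : expR r - 1 <= r * expR r.
Proof.
have := expR_ge1Dx (- r); have := expR_gt0 r => e0 h.
have : expR r * (1 + - r) <= expR r * expR (- r) by rewrite ler_pM2l.
by rewrite -expRD subrr expR0; lra.
Qed.

Lemma expR_sub1_small (C e : R) : 0 <= C -> 0 < e ->
  exists2 r, 0 < r & forall s, s <= r -> C * (expR s - 1) <= e.
Proof.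
move=> C0 e0; have C1 : 0 < C * expR 1 + 1.
  by rewrite ltr_wpDl // mulr_ge0 ?expR_ge0.
pose r := Num.min 1 (e / (C * expR 1 + 1)).
have r0 : 0 < r by rewrite lt_min ltr01 divr_gt0.
exists r => // s sr.
have h1 : expR s - 1 <= expR r - 1 by rewrite lerD2r ler_expR.
have h2 : expR r <= expR 1 by rewrite ler_expR ge_min lexx.
have h3 : r * (C * expR 1 + 1) <= e by rewrite -ler_pdivlMr // ge_min lexx orbT.
apply: le_trans (ler_wpM2l C0 (le_trans h1 (expR_sub1_le r))) _.
have := ler_wpM2l (mulr_ge0 C0 (ltW r0)) h2; lra.
Qed.

Lemma decay_small (a r e : R) : 0 < a -> 0 <= r -> 0 < e ->
  exists2 T, 0 <= T & forall t, T <= t -> r * expR (- (a * t)) <= e.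
Proof.
move=> a0 r0 e0; exists (r / (a * e)); first by rewrite divr_ge0 // mulr_ge0 // ltW.
move=> t; rewrite ler_pdivrMr ?mulr_gt0 // => h.
have := expR_ge1Dx (a * t); have := expR_gt0 (a * t) => p0 p1.
rewrite expRN ler_pdivrMr //.
have := ler_wpM2l (ltW e0) p1; lra.
Qed.

Lemma tle_nbd r c P Q : sym_op P -> sym_op Q ->
  (forall x, ip (P x) x <= c * ip x x) ->
  (forall x, ip (Q x) x <= c * ip x x) -> 0 <= r ->
  tle r P Q -> nbd (P - Q) (c * (expR r - 1)).
Proof.
move=> sP sQ hP hQ r0 [h1 h2]; apply: sym_nbd => [|x]; first exact: symB.
have e1 : 0 <= expR r - 1 by rewrite subr_ge0 -expR0 ler_expR.
rewrite !fctE ipBl ler_norml; have := h1 x; have := h2 x.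
have := ler_wpM2l e1 (hP x); have := ler_wpM2l e1 (hQ x).
by move=> ? ? ? ?; apply/andP; split; lra.
Qed.

Lemma tle_eq c P Q : sym_op P -> sym_op Q -> 0 <= c ->
  (forall x, 0 <= ip (P x) x <= c * ip x x) ->
  (forall x, 0 <= ip (Q x) x <= c * ip x x) ->
  (forall e, 0 < e -> exists2 r, 0 <= r <= e & tle r P Q) -> P = Q.
Proof.
move=> sP sQ c0 hP hQ h; apply/funext => x; apply/eqP.
rewrite -subr_eq0; apply/eqP/nr_eq0/le_anti; rewrite nr_ge0 andbT.
rewrite -oppr_ge0; apply: (ge0_limit (b := nr x)); first exact: nr_ge0.
move=> e e0; have [r r0 hr] := expR_sub1_small c0 e0.
have [s /andP[s0 sr] hs] := h r r0.
have := tle_nbd sP sQ _ _ s0 hs x; rewrite !fctE => hn.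
have {hn} : nr (P x - Q x) <= c * (expR s - 1) * nr x.
  by apply: hn => y; [have /andP[] := hP y|have /andP[] := hQ y].
have := ler_wpM2r (nr_ge0 x) (hr s sr); lra.
Qed.

Lemma le_op_scaleP r P Q : sym_op P -> sym_op Q ->
  le_op P (scale_op r Q) <-> forall x, ip (P x) x <= r * ip (Q x) x.
Proof.
move=> sP sQ; rewrite (le_opP sP (symZ r sQ)).
by split=> h x; have := h x; rewrite ip_scale_op.
Qed.

Lemma thompson_M_le P Q r : 0 <= r -> le_op P (scale_op r Q) -> thompson_M P Q <= r.
Proof.
move=> r0 h; rewrite /thompson_M; set A := [set t | _].
have [hl|hl] := pselect (has_lbound A); first exact: ge_inf.
by rewrite inf_out // => -[_ /hl].
Qed.

Lemma thompson_dist_le P Q r : sym_op P -> sym_op Q -> 0 <= r ->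
  tle r P Q -> thompson_dist P Q <= r.
Proof.
move=> sP sQ r0 [h1 h2].
have m1 : thompson_M P Q <= expR r.
  by apply: thompson_M_le; rewrite ?expR_ge0 //; apply/le_op_scaleP.
have m2 : thompson_M Q P <= expR r.
  by apply: thompson_M_le; rewrite ?expR_ge0 //; apply/le_op_scaleP.
rewrite /thompson_dist; set m := Num.max _ _.
have mr : m <= expR r by rewrite ge_max m1.
have [m0|m0] := leP m 0; first by rewrite ln0.
by rewrite -(expRK r) ler_ln ?posrE ?expR_gt0.
Qed.

(** The infimum in [M(P/Q)] is attained. On the zero space the infimum is that
    of all reals, which is [0] by convention, and the distance is [ln 0 = 0]. *)
Lemma thompson_distP P Q : pos_op P -> pos_op Q ->
  0 <= thompson_dist P Q /\ tle (thompson_dist P Q) P Q.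
Proof.
move=> /pos_opP[sP [p p0 hP]] /pos_opP[sQ [q q0 hQ]].
have [[x0 x00]|triv] := pselect (exists x : E, x <> 0); last first.
  have z (x : E) : x = 0 by apply: contrapT => xn; apply: triv; exists x.
  have M0 (U V : E -> E) : sym_op U -> sym_op V -> thompson_M U V = 0.
    move=> sU sV; apply: inf_out => -[_ [b hb]].
    have /hb : le_op U (scale_op (b - 1) V).
      by apply/le_op_scaleP => // x; rewrite (z (U x)) (z (V x)) !ip0l mulr0.
    by lra.
  rewrite /thompson_dist !M0 // maxxx ln0 //; split=> //.
  by split=> x; rewrite (z (P x)) (z (Q x)) !ip0l mulr0.
have N0 : 0 < ip x0 x0 by rewrite -nr_sqr exprn_gt0 // nr_gt0.
have att U V u v : sym_op U -> sym_op V -> 0 < u -> 0 < v ->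
    (forall x, u * ip x x <= ip (U x) x) -> (forall x, v * ip x x <= ip (V x) x) ->
    0 <= thompson_M U V /\ forall x, ip (U x) x <= thompson_M U V * ip (V x) x.
  move=> sU sV u0 v0 hU hV; rewrite /thompson_M; set A := [set t | _].
  have lbA : lbound A 0.
    move=> t /(le_op_scaleP _ sU sV) /(_ x0) h.
    have := hU x0; have := hV x0; have := mulr_gt0 u0 N0; have := mulr_gt0 v0 N0.
    move=> a1 a2 a3 a4; rewrite leNgt; apply/negP => t0.
    have : t * ip (V x0) x0 < 0 by rewrite nmulr_rlt0 //; lra.
    lra.
  have A0 : A !=set0.
    have [c c0 hc] := sym_bd sU; exists (c / v); apply/le_op_scaleP => // x.
    have := nbd_ip_norm x hc; rewrite ler_norml => /andP[_ h1].
    apply: le_trans h1 _; rewrite mulrAC ler_pdivlMr // -mulrA ler_wpM2l //.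
    by rewrite mulrC.
  have hA : has_inf A by split=> //; exists 0.
  split; first exact: lb_le_inf.
  move=> x; rewrite -subr_ge0; apply: (ge0_limit (b := ip (V x) x)).
    by apply: le_trans (hV x); rewrite mulr_ge0 ?ip_ge0 // ltW.
  move=> e e0; have [t At te] := inf_adherent e0 hA.
  have := (le_op_scaleP _ sU sV).1 At x.
  have v1 : 0 <= ip (V x) x by apply: le_trans (hV x); rewrite mulr_ge0 ?ip_ge0 // ltW.
  have := ler_wpM2r v1 (ltW te); lra.
have [m1 h1] := att P Q p q sP sQ p0 q0 hP hQ.
have [m2 h2] := att Q P q p sQ sP q0 p0 hQ hP.
have P0 x : 0 <= ip (P x) x by apply: le_trans (hP x); rewrite mulr_ge0 ?ip_ge0 // ltW.
have Q0 x : 0 <= ip (Q x) x by apply: le_trans (hQ x); rewrite mulr_ge0 ?ip_ge0 // ltW.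
rewrite /thompson_dist; set a := thompson_M P Q in m1 h1 *.
set b := thompson_M Q P in m2 h2 *; set m := Num.max a b.
have am : a <= m by rewrite le_max lexx.
have bm : b <= m by rewrite le_max lexx orbT.
have mge1 : 1 <= m.
  rewrite leNgt; apply/negP => mlt1.
  have Px : 0 < ip (P x0) x0 by apply: lt_le_trans (hP x0); rewrite mulr_gt0.
  have Qx : 0 < ip (Q x0) x0 by apply: lt_le_trans (hQ x0); rewrite mulr_gt0.
  have a1 : a * ip (Q x0) x0 < ip (Q x0) x0 by rewrite gtr_pMl //; lra.
  have b1 : b * ip (P x0) x0 < ip (P x0) x0 by rewrite gtr_pMl //; lra.
  by have := h1 x0; have := h2 x0; lra.
have m0 : 0 < m by lra.
split; first exact: ln_ge0.
rewrite /tle lnK ?posrE //; split=> x.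
  by apply: le_trans (h1 x) _; rewrite ler_wpM2r.
by apply: le_trans (h2 x) _; rewrite ler_wpM2r.
Qed.

End ThompsonMetric.

(** * The flow on order intervals and its stationary point *)

Section GlobalSolutions.
Context {R : realType} {k : scalar_kind} {E : hilbert_space R k}.
Implicit Types (x y z : E) (r c t s : R) (P Q : E -> E) (X Y : R -> E -> E)
  (J : set R).
Variables A D S : E -> E.
Hypothesis bA : bounded_op A.
Hypothesis bA' : bounded_op (adjoint A).
Hypothesis adjA : forall x y, ip (A x) y = ip x (adjoint A y).
Hypothesis sD : sym_op D.
Hypothesis sS : sym_op S.
Local Notation rhs := (riccati_rhs A D S).
Local Notation sol := (riccati_solution A D S).

(** The length of the interval depends on a bound for the initial value only. *)
Lemma local_existence b : 0 < b -> exists2 h, 0 < h &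
  forall P, sym_op P -> nbd P b -> exists X, sol `[0, h] P X.
Proof.
move=> b0; have /bounded_opP[_ [a1 a10 ha1]] := bA.
have /bounded_opP[_ [a2 a20 ha2]] := bA'.
have [dd dd0 hd] := sym_bd sD; have [c c0 hc] := sym_bd sS.
pose a := Num.max a1 a2.
pose u := 2 * a * b + dd + c * b ^+ 2.
pose rho := Num.max 1 (u / b).
have rho1 : 1 <= rho by rewrite le_max lexx.
have rho0 : 0 < rho by lra.
exists (1 / (8 * rho)); first by rewrite divr_gt0 // mulr_gt0.
move=> P sP nP.
have nA : nbd A a by apply: nbdW ha1; rewrite le_max lexx.
have nA' : nbd (adjoint A) a by apply: nbdW ha2; rewrite le_max lexx orbT.
apply: (power_series_solution bA bA' adjA sD sS nA nA' hd hc (b := b) (rho := rho)) => //.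
- by rewrite le_max a10.
- by rewrite divr_gt0 // mulr_gt0.
- by rewrite [leRHS]mulrC -ler_pdivrMr // le_max lexx orbT.
- by rewrite le_eqVlt; apply/orP; left; apply/eqP; field; rewrite gt_eqF.
Qed.

Lemma solution_shift J J' P X a : (forall t, J' t -> J (a + t)) ->
  sol J P X -> sol J' (X a) (fun t => X (a + t)).
Proof.
move=> JJ /riccati_solutionP[_ h]; apply/riccati_solutionP; rewrite addr0.
split=> // t /JJ Jt; have [sX dX] := h _ Jt; split=> // e e0.
have [d d0 hd] := dX e e0; exists d => // s /JJ Js.
by have := hd _ Js; rewrite opprD addrACA subrr add0r.
Qed.

Lemma solution_glue T1 T2 P X1 X2 : 0 <= T1 -> 0 <= T2 ->
  sol `[0, T1] P X1 -> sol `[0, T2] (X1 T1) X2 -> exists X, sol `[0, T1 + T2] P X.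
Proof.
move=> T10 T20 s1 s2; pose X t := if t <= T1 then X1 t else X2 (t - T1).
have X20 : X2 0 = X1 T1 by exact: s2.1.
have right t : T1 <= t -> X t = X2 (t - T1).
  rewrite /X le_eqVlt => /orP[/eqP <-|]; first by rewrite lexx subrr.
  by move=> h; rewrite leNgt h.
have left t : t <= T1 -> X t = X1 t by move=> h; rewrite /X h.
(* One-sided estimates on either side of [T1]; both apply at [T1]. *)
have dl t e : 0 <= t -> t <= T1 -> 0 < e -> exists2 d, 0 < d &
    forall s, 0 <= s -> s <= T1 -> `|s - t| < d ->
      nbd (X s - X t - scale_op (s - t) (rhs (X t))) (e * `|s - t|).
  move=> t0 tT e0; have [d d0 hd] := solution_deriv s1 t0 tT e0; exists d => // s s0 sT.
  by rewrite !left //; apply: hd; apply/in_seg.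
have dr t e : T1 <= t -> t <= T1 + T2 -> 0 < e -> exists2 d, 0 < d &
    forall s, T1 <= s -> s <= T1 + T2 -> `|s - t| < d ->
      nbd (X s - X t - scale_op (s - t) (rhs (X t))) (e * `|s - t|).
  move=> t0 tT e0.
  have t0' : 0 <= t - T1 by lra.
  have tT' : t - T1 <= T2 by lra.
  have [d d0 hd] := solution_deriv s2 t0' tT' e0; exists d => // s s0 sT sd.
  rewrite !right //; have := hd (s - T1); rewrite opprB addrA subrK; apply => //.
  by apply/in_seg; lra.
exists X; apply/riccati_solutionP; split; first by rewrite left // s1.1.
move=> t /in_seg[t0 tT]; split.
  have [tl|tr] := leP t T1; first by rewrite left //; exact: (solution_sym s1).
  by rewrite right ?ltW //; apply: (solution_sym s2); lra.
move=> e e0; have [tl|tl] := ltP t T1.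
  have [d d0 hd] := dl t e t0 (ltW tl) e0.
  exists (Num.min d (T1 - t)); first by rewrite lt_min d0 subr_gt0.
  move=> s /in_seg[s0 sT]; rewrite lt_min => /andP[sd].
  by rewrite ltr_norml => /andP[_ ?]; apply: hd => //; lra.
have [d d0 hd] := dr t e tl tT e0.
have [tr|tr] := ltP T1 t.
  exists (Num.min d (t - T1)); first by rewrite lt_min d0 subr_gt0.
  move=> s /in_seg[s0 sT]; rewrite lt_min => /andP[sd].
  by rewrite ltr_norml => /andP[? _]; apply: hd => //; lra.
have [d' d'0 hd'] := dl t e t0 tr e0.
exists (Num.min d d'); first by rewrite lt_min d0.
move=> s /in_seg[s0 sT]; rewrite lt_min => /andP[sd sd'].
by have [sl|sr] := leP s T1; [exact: hd'|apply: hd => //; exact: ltW].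
Qed.

Lemma riccati_flowE T P X t : sol `[0, T] P X -> 0 <= t -> t <= T ->
  riccati_flow A D S t P = X t.
Proof.
move=> sX t0 tT.
have sXt : sol `[0, t] P X.
  by apply: solution_sub sX => s /in_seg[s0 st]; apply/in_seg; lra.
rewrite /riccati_flow; case: xgetP => [Y _ [X' sX' <-]|/(_ (X t)) []].
  exact: (solution_unique bA bA' adjA sD sS sX' sXt).
by exists X.
Qed.

Lemma stationary_solution J P : sym_op P -> rhs P = 0 -> sol J P (fun=> P).
Proof.
move=> sP h; apply/riccati_solutionP; split=> // t _; split=> // e e0.
exists 1 => // s _ _ x; rewrite h !fctE subrr sub0r nrN scale_opE scaler0 nr0.
by rewrite !mulr_ge0 ?nr_ge0 // ltW.
Qed.

Lemma constant_solution_stationary T P : 0 < T -> sol `[0, T] P (fun=> P) -> rhs P = 0.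
Proof.
move=> T0 sP; apply/funext => x; apply: nr_eq0; apply/le_anti; rewrite nr_ge0 andbT.
rewrite -oppr_ge0; apply: (ge0_limit (b := nr x)); first exact: nr_ge0.
move=> e e0; have [d d0 hd] := solution_deriv sP (lexx 0) (ltW T0) e0.
pose s := Num.min (d / 2) T.
have s0 : 0 < s by rewrite lt_min T0 divr_gt0.
have sd : s <= d / 2 by rewrite ge_min lexx.
have sT : s <= T by rewrite ge_min lexx orbT.
have := hd s; rewrite subr0 gtr0_norm // => h.
have : nr ((P - P - scale_op s (rhs P)) x) <= e * s * nr x.
  by apply: h; [apply/in_seg; lra|lra].
rewrite !fctE subrr sub0r nrN scale_opE nrZ gtr0_norm // => {}h.
have : 0 <= s * (e * nr x - nr (rhs P x)) by lra.
by rewrite pmulr_rge0 //; lra.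
Qed.

(* [lambda_super] makes [lambda I] a supersolution and [d0_sub] makes [d I] a
   subsolution for [d <= d0], so that the order intervals between them are
   invariant. *)
Variables lambda mD cS alpha d0 : R.
Hypotheses (lambda0 : 0 < lambda) (mD0 : 0 < mD) (cS0 : 0 < cS) (alpha0 : 0 < alpha).
Hypothesis alphaE : alpha * lambda = mD - cS * lambda ^+ 2.
Hypothesis hmD : forall x, mD * ip x x <= ip (D x) x.
Hypothesis hS : forall x, - cS * ip x x <= ip (S x) x.
Hypothesis lambda_super : forall x, ric_form A D S (scalar_op lambda) x <= 0.
Hypothesis d0_gt0 : 0 < d0.
Hypothesis d0_sub : forall d x, 0 <= d -> d <= d0 -> 0 <= ric_form A D S (scalar_op d) x.

Definition order_box d P :=
  sym_op P /\ forall x, d * ip x x <= ip (P x) x <= lambda * ip x x.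

Lemma box_upto P : pos_op_upto lambda P <->
  exists d, [/\ 0 < d, d <= d0 & order_box d P].
Proof.
split=> [[pP lP]|[d [dg0 dd0 [sP hP]]]].
  have /pos_opP[sP [e e0 he]] := pP; exists (Num.min d0 e); split.
  - by rewrite lt_min d0_gt0.
  - by rewrite ge_min lexx.
  - split=> // x; apply/andP; split; last by rewrite -ip_scalar_op le_op_form.
    apply: le_trans (he x); rewrite ler_wpM2r ?ip_ge0 //.
    by rewrite ge_min lexx orbT.
split.
  by apply/pos_opP; split=> //; exists d => // x; have /andP[] := hP x.
apply/le_opP => //; first exact: sym_scalar.
by move=> x; rewrite ip_scalar_op; have /andP[] := hP x.
Qed.

Lemma box_form d P x : 0 <= d -> order_box d P -> 0 <= ip (P x) x <= lambda * ip x x.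
Proof.
move=> dg [_ /(_ x) /andP[h ->]]; rewrite andbT.
by apply: le_trans h; rewrite mulr_ge0 ?ip_ge0.
Qed.

Lemma box_nbd d P : 0 <= d -> order_box d P -> nbd P lambda.
Proof.
move=> dg bP; apply: sym_nbd => [|x]; first by case: bP.
by have /andP[? ?] := box_form x dg bP; rewrite ger0_norm.
Qed.

Lemma box_invariant d T P X : 0 < d -> d <= d0 -> order_box d P -> sol `[0, T] P X ->
  forall t, 0 <= t -> t <= T -> order_box d (X t).
Proof.
move=> dg dd [sP hP] sX t t0 tT; split; first exact: (solution_sym sX).
move=> x; apply/andP; split.
  apply: (solution_ge_scalar bA bA' adjA sD sS sX) => // y.
    by apply: d0_sub => //; exact: ltW.
  by have /andP[] := hP y.
apply: (solution_le_scalar bA bA' adjA sD sS sX) => // y.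
by have /andP[] := hP y.
Qed.

Lemma global_existence d P T : 0 < d -> d <= d0 -> order_box d P ->
  exists X, sol `[0, T] P X.
Proof.
move=> dg dd bP; have [h h0 hloc] := local_existence lambda0.
have sols n : forall Q, order_box d Q -> exists X, sol `[0, n%:R * h] Q X.
  elim: n => [|n IH] Q bQ; have [X sX] := hloc Q bQ.1 (box_nbd (ltW dg) bQ).
    by exists X; apply: solution_sub sX => t /in_seg[t0 tT]; apply/in_seg; lra.
  have [X' sX'] := IH _ (box_invariant dg dd bQ sX (ltW h0) (lexx h)).
  rewrite -natr1 mulrDl mul1r addrC.
  by apply: (solution_glue _ _ sX sX'); rewrite ?mulr_ge0 // ltW.
have [T0|T0] := leP 0 T; last first.
  have [X sX] := sols 0%N P bP; exists X; apply: solution_sub sX => t /in_seg[t0 tT].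
  by have := le_lt_trans (le_trans t0 tT) T0; rewrite ltxx.
have := archi_boundP (divr_ge0 T0 (ltW h0)); rewrite ltr_pdivrMr // => hT.
have [X sX] := sols (Num.bound (T / h)) P bP; exists X.
by apply: solution_sub sX => t /in_seg[t0 tT]; apply/in_seg; lra.
Qed.

Local Notation M := (riccati_flow A D S).

Lemma flow_solution d P : 0 < d -> d <= d0 -> order_box d P ->
  sol `[0, +oo[ P (fun t => M t P).
Proof.
move=> dg dd bP; apply/riccati_solutionP; split.
  have [X sX] := global_existence 0 dg dd bP.
  by rewrite (riccati_flowE sX) // sX.1.
move=> t /=; rewrite in_itv /= andbT => t0.
have [X sX] := global_existence (t + 1) dg dd bP.
have Mt s : 0 <= s -> s <= t + 1 -> M s P = X s by exact: riccati_flowE.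
have tT : t <= t + 1 by lra.
rewrite Mt //; split; first exact: (solution_sym sX).
move=> e e0; have [c c0 hc] := solution_deriv sX t0 tT e0.
exists (Num.min 1 c); first by rewrite lt_min ltr01.
move=> s; rewrite /= in_itv /= andbT lt_min => s0 /andP[s1 sc].
have sT : s <= t + 1 by move: s1; rewrite ltr_norml => /andP[]; lra.
by rewrite (Mt s) // (Mt t) //; apply: hc => //; apply/in_seg.
Qed.

Lemma flow_segment d P T : 0 < d -> d <= d0 -> order_box d P ->
  sol `[0, T] P (fun t => M t P).
Proof.
move=> dg dd bP; apply: solution_sub (flow_solution dg dd bP) => t /in_seg[t0 _].
by rewrite /= in_itv /= andbT.
Qed.

Lemma flow_box d P t : 0 < d -> d <= d0 -> order_box d P -> 0 <= t ->
  order_box d (M t P).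
Proof.
move=> dg dd bP t0; apply: (box_invariant dg dd bP (flow_segment t dg dd bP)) => //.
Qed.

Lemma solution_tle d1 d2 r T P1 P2 X1 X2 : 0 < d1 -> d1 <= d0 -> 0 < d2 -> d2 <= d0 ->
  order_box d1 P1 -> order_box d2 P2 -> sol `[0, T] P1 X1 -> sol `[0, T] P2 X2 ->
  0 <= r -> tle r P1 P2 ->
  forall t, 0 <= t -> t <= T -> tle (r * expR (- (alpha * t))) (X1 t) (X2 t).
Proof.
move=> g1 l1 g2 l2 b1 b2 s1 s2 r0 [h1 h2] t t0 tT.
have f1 s : 0 <= s -> s <= T -> forall x, 0 <= ip (X1 s x) x <= lambda * ip x x.
  by move=> s0 sT x; apply: box_form (ltW g1) (box_invariant g1 l1 b1 s1 s0 sT).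
have f2 s : 0 <= s -> s <= T -> forall x, 0 <= ip (X2 s x) x <= lambda * ip x x.
  by move=> s0 sT x; apply: box_form (ltW g2) (box_invariant g2 l2 b2 s2 s0 sT).
split.
  exact: (solution_contraction bA bA' adjA sD sS s1 s2 (ltW lambda0) r0 (ltW mD0)
    (ltW cS0) (ltW alpha0) alphaE hmD hS f1 h1 t0 tT).
exact: (solution_contraction bA bA' adjA sD sS s2 s1 (ltW lambda0) r0 (ltW mD0)
  (ltW cS0) (ltW alpha0) alphaE hmD hS f2 h2 t0 tT).
Qed.

Lemma flow_contraction P1 P2 t : pos_op_upto lambda P1 -> pos_op_upto lambda P2 ->
  0 <= t -> thompson_dist (M t P1) (M t P2) <= expR (- (alpha * t)) * thompson_dist P1 P2.
Proof.
move=> u1 u2 t0; have [r0 hr] := thompson_distP u1.1 u2.1.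
have /box_upto[d1 [g1 l1 b1]] := u1; have /box_upto[d2 [g2 l2 b2]] := u2.
rewrite mulrC; apply: thompson_dist_le.
- by case: (flow_box g1 l1 b1 t0).
- by case: (flow_box g2 l2 b2 t0).
- by rewrite mulr_ge0 ?expR_ge0.
- exact: (solution_tle g1 l1 g2 l2 b1 b2 (flow_segment t g1 l1 b1)
    (flow_segment t g2 l2 b2) r0 hr t0 (lexx t)).
Qed.

Lemma stationary_unique P Q : pos_op_upto lambda P -> pos_op_upto lambda Q ->
  rhs P = 0 -> rhs Q = 0 -> P = Q.
Proof.
move=> uP uQ hP hQ.
have /box_upto[d1 [g1 l1 b1]] := uP; have /box_upto[d2 [g2 l2 b2]] := uQ.
have [r0 hr] := thompson_distP uP.1 uQ.1.
apply: (@tle_eq _ _ _ lambda) b1.1 b2.1 (ltW lambda0) _ _ _ => [x|x|e e0].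
- exact: box_form (ltW g1) b1.
- exact: box_form (ltW g2) b2.
have [T T0 hT] := decay_small alpha0 r0 e0.
exists (thompson_dist P Q * expR (- (alpha * T))).
  by rewrite mulr_ge0 ?expR_ge0 //= hT.
exact: (@solution_tle _ _ _ T _ _ (fun=> P) (fun=> Q) g1 l1 g2 l2 b1 b2
  (stationary_solution _ b1.1 hP) (stationary_solution _ b2.1 hQ) r0 hr T T0 (lexx T)).
Qed.

(** A trajectory [X] converges: [X] and its translate [X (s + .)] are two
    solutions, so their distance decays like [exp(- alpha t)] uniformly in [s].
    The solution starting from the limit stays within the same distance of [X],
    hence it is constant. *)
Lemma stationary_exists : exists2 P, pos_op_upto lambda P & rhs P = 0.
Proof.
have lam0 := lambda0; have d00 := d0_gt0.
pose d := Num.min d0 lambda.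
have dg : 0 < d by rewrite lt_min d0_gt0.
have dd : d <= d0 by rewrite ge_min lexx.
have dl : d <= lambda by rewrite ge_min lexx orbT.
pose P0 : E -> E := scalar_op lambda.
have b0 : order_box d P0.
  split=> [|x]; first exact: sym_scalar.
  by rewrite ip_scalar_op lexx andbT ler_wpM2r ?ip_ge0.
pose X t := M t P0.
have solX : sol `[0, +oo[ P0 X by exact: flow_solution dg dd b0.
have bX t : 0 <= t -> order_box d (X t) by exact: flow_box.
have shift s T : 0 <= s -> sol `[0, T] (X s) (fun t => X (s + t)).
  move=> s0; apply: solution_shift solX => t /in_seg[t0 _].
  by rewrite /= in_itv /= andbT addr_ge0.
pose r := ln (lambda / d).
have ld : 1 <= lambda / d by rewrite ler_pdivlMr // mul1r.
have r0 : 0 <= r by rewrite ln_ge0.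
have er : expR r = lambda / d by rewrite lnK ?posrE //; lra.
have diam P Q : order_box d P -> order_box d Q -> tle r P Q.
  move=> [_ hP] [_ hQ]; rewrite /tle er; split=> x.
    have /andP[_ h1] := hP x; have /andP[h2 _] := hQ x.
    apply: le_trans h1 _; rewrite mulrAC ler_pdivlMr // -mulrA ler_wpM2l ?(ltW lambda0) //.
    by rewrite mulrC.
  have /andP[_ h1] := hQ x; have /andP[h2 _] := hP x.
  apply: le_trans h1 _; rewrite mulrAC ler_pdivlMr // -mulrA ler_wpM2l ?(ltW lambda0) //.
  by rewrite mulrC.
pose rho t := r * expR (- (alpha * t)).
have rho0 t : 0 <= rho t by rewrite mulr_ge0 ?expR_ge0.
have close s t : 0 <= s -> 0 <= t -> tle (rho t) (X (s + t)) (X t).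
  move=> s0 t0; have b1 := bX s s0.
  have sX : sol `[0, t] P0 X.
    apply: solution_sub solX => u /in_seg[u0 _]; by rewrite /= in_itv /= andbT.
  exact: (solution_tle dg dd dg dd b1 b0 (shift s t s0) sX r0 (diam _ _ b1 b0) t0 (lexx t)).
have natge (n : nat) : 0 <= n%:R :> R by exact: ler0n.
have symX t : 0 <= t -> sym_op (X t) by move=> /bX[].
have upX t : 0 <= t -> forall x, ip (X t x) x <= lambda * ip x x.
  by move=> t0 x; have /andP[] := box_form x (ltW dg) (bX t t0).
have [Pb sPb cPb] : exists2 P, sym_op P & op_cvg (fun n => X n%:R) P.
  apply: op_complete => [n|e e0]; first exact: symX.
  have [q q0 hq] := expR_sub1_small (ltW lambda0) e0.
  have [T T0 hT] := decay_small alpha0 r0 q0.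
  have near m n : (Num.bound T <= n)%N -> (n <= m)%N -> nbd (X m%:R - X n%:R) e.
    move=> Nn nm; have Tn : T <= n%:R.
      by apply: le_trans (ltW (archi_boundP T0)) _; rewrite ler_nat.
    have mn : 0 <= m%:R - n%:R :> R by rewrite subr_ge0 ler_nat.
    have := close _ _ mn (natge n); rewrite subrK => tl.
    apply: nbdW (tle_nbd (symX _ (natge m)) (symX _ (natge n)) (upX _ (natge m))
      (upX _ (natge n)) (rho0 _) tl).
    by apply: hq; exact: hT.
  exists (Num.bound T) => m n Nm Nn; case: (leqP n m) => [nm|/ltnW mn].
    exact: near.
  by move=> x; rewrite !fctE nrBC; exact: near.
(* Closed conditions on forms pass to the limit. *)
have lim_form (a b : R) U x : (forall n, (U <= n)%N -> 0 <= a + b * ip (X n%:R x) x) ->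
    0 <= a + b * ip (Pb x) x.
  move=> hU; apply: (ge0_limit (b := `|b| * ip x x)).
    by rewrite mulr_ge0 ?ip_ge0.
  move=> e e0; have [N hN] := cPb e e0.
  have := hU (maxn N U) (leq_maxr _ _).
  have := nbd_ip_norm x (hN (maxn N U) (leq_maxl _ _)).
  rewrite !fctE ipBl; set u := ip (X _ x) x; set v := ip (Pb x) x => h1 h2.
  have : b * (u - v) <= `|b| * (e * ip x x).
    apply: le_trans (ler_norm _) _; rewrite normrM ler_wpM2l //.
  lra.
have bPb : order_box d Pb.
  split=> // x; apply/andP; split.
    have := @lim_form (- (d * ip x x)) 1 0%N x; rewrite mul1r => h.
    suff : 0 <= - (d * ip x x) + ip (Pb x) x by lra.
    by apply: h => n _; have [_ /(_ x) /andP[h1 _]] := bX _ (natge n); lra.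
  have := @lim_form (lambda * ip x x) (-1) 0%N x; rewrite mulN1r subr_ge0; apply.
  by move=> n _; rewrite mulN1r subr_ge0; exact: upX.
have closeb n : tle (rho n%:R) Pb (X n%:R).
  split=> x.
    have := @lim_form (expR (rho n%:R) * ip (X n%:R x) x) (-1) n x.
    rewrite mulN1r subr_ge0; apply => m nm; rewrite mulN1r subr_ge0.
    have mn : 0 <= m%:R - n%:R :> R by rewrite subr_ge0 ler_nat.
    by have [+ _] := close _ _ mn (natge n); rewrite subrK; exact.
  have := @lim_form (- ip (X n%:R x) x) (expR (rho n%:R)) n x.
  rewrite addrC subr_ge0; apply => m nm; rewrite addrC subr_ge0.
  have mn : 0 <= m%:R - n%:R :> R by rewrite subr_ge0 ler_nat.
  by have [_ +] := close _ _ mn (natge n); rewrite subrK; exact.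
exists Pb; first by apply/box_upto; exists d.
apply: (@constant_solution_stationary 1) => //.
have fix_ t : 0 <= t -> M t Pb = Pb.
  move=> t0; have bY := flow_box dg dd bPb t0.
  apply: (@tle_eq _ _ _ lambda) bY.1 sPb (ltW lambda0) _ _ _ => [x|x|e e0].
  - exact: box_form (ltW dg) bY.
  - exact: box_form (ltW dg) bPb.
  have e3 : 0 < e / 3 by lra.
  have [T T0 hT] := decay_small alpha0 r0 e3.
  pose n := Num.bound T; have n0 := natge n.
  have rn : rho n%:R <= e / 3 by apply: hT; exact: ltW (archi_boundP T0).
  have bXn := bX _ n0.
  have t1 := solution_tle dg dd dg dd bPb bXn (flow_segment t dg dd bPb)
    (shift _ t n0) (rho0 n%:R) (closeb n) t0 (lexx t).
  have {}t1 : tle (rho n%:R) (M t Pb) (X (n%:R + t)).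
    have nt : 0 <= n%:R + t by rewrite addr_ge0.
    apply: tle_weak t1 => [x|x|].
    - by have /andP[] := box_form x (ltW dg) bY.
    - by have /andP[] := box_form x (ltW dg) (bX _ nt).
    - rewrite ler_piMr // -expR0 ler_expR oppr_le0 mulr_ge0 // ltW //.
  have t2 := close _ _ t0 n0; rewrite [t + _]addrC in t2.
  exists (rho n%:R + rho n%:R + rho n%:R).
    by have rn0 := rho0 n%:R; apply/andP; split; lra.
  exact: tle_trans (tle_trans t1 t2) (tleC (closeb n)).
have := flow_segment 1 dg dd bPb; move=> /riccati_solutionP[_ h].
apply/riccati_solutionP; split=> // t Jt; have [sX dX] := h t Jt; split=> //.
have /in_seg[t0 _] := Jt; rewrite (fix_ t t0) in dX.
move=> e e0; have [c c0 hc] := dX e e0; exists c => // s Js sc.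
have /in_seg[s0 _] := Js; have := hc s Js sc.
by rewrite (fix_ s s0) (fix_ t t0).
Qed.

End GlobalSolutions.
(** * The theorem *)

Section Constants.
Context {R : realType}.
Implicit Types (cA cD mD cS lambda : R).

Lemma disc_sqrt_lt cA cD cS : 0 < cA -> 0 < cD * cS ->
  Num.sqrt (cA ^+ 2 - cD * cS) < cA.
Proof.
move=> cA0 p; rewrite -[ltRHS](gtr0_norm cA0) -sqrtr_sqr ltr_sqrt ?exprn_gt0 //.
lra.
Qed.

(** [lambda] lies between the roots of [cS X^2 - 2 cA X + cD]: it is at least
    the smaller one, and [lambda^2 < mD / cS] is at most their product. *)
Lemma between_roots cA cD mD cS lambda : 0 < cA -> 0 < cD -> 0 < cS ->
  cD * cS <= cA ^+ 2 -> mD <= cD ->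
  (cA - Num.sqrt (cA ^+ 2 - cD * cS)) / cS <= lambda ->
  cS * lambda ^+ 2 < mD -> cD - 2 * cA * lambda + cS * lambda ^+ 2 <= 0.
Proof.
move=> cA0 cD0 cS0 disc mc; have p0 : 0 < cD * cS by rewrite mulr_gt0.
have := disc_sqrt_lt cA0 p0.
have : Num.sqrt (cA ^+ 2 - cD * cS) ^+ 2 = cA ^+ 2 - cD * cS.
  by rewrite sqr_sqrtr // subr_ge0.
have := sqrtr_ge0 (cA ^+ 2 - cD * cS).
move: (Num.sqrt _) => s s0 s2 sA; rewrite ler_pdivrMr // => hl hu.
have low : 0 <= cS * lambda - cA + s by lra.
have hi : cS * lambda <= cA + s.
  rewrite leNgt; apply/negP => h.
  have : (cA + s) ^+ 2 < (cS * lambda) ^+ 2.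
    by rewrite ltrXn2r ?nnegrE // ?addr_ge0 ?(ltW cA0) //; lra.
  have := ler_wpM2l (ltW cS0) (ltW hu); have := ler_wpM2l (ltW cS0) mc.
  have : 0 <= s * (cA + s) by rewrite mulr_ge0 // addr_ge0 // ltW.
  nra.
have : 0 <= (cS * lambda - cA + s) * (cA + s - cS * lambda).
  by rewrite mulr_ge0 // subr_ge0.
move=> h; have : cS * (cD - 2 * cA * lambda + cS * lambda ^+ 2) <= 0 by nra.
by rewrite pmulr_rle0.
Qed.

End Constants.

Theorem corollary4p6 (R : realType) (k : scalar_kind) (E : hilbert_space R k)
    (A D Sigma : E -> E) (cA cD mD cS : R)
    (bA : bounded_op A) (sD : sym_op D) (sSigma : sym_op Sigma)
    (hA : le_op (A + adjoint A) (scalar_op (- (2 * cA))))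
    (hmD : le_op (scalar_op mD) D) (hcD : le_op D (scalar_op cD))
    (hSigma : le_op (scalar_op (- cS)) Sigma)
    (cA_gt0 : 0 < cA) (cD_gt0 : 0 < cD) (mD_gt0 : 0 < mD) (cS_gt0 : 0 < cS)
    (hdisc : cD * cS <= cA ^+ 2)
    (hgap : (cA - Num.sqrt (cA ^+ 2 - cD * cS)) ^+ 2 < cS * mD)
    (lambda : R)
    (lambda_ge : (cA - Num.sqrt (cA ^+ 2 - cD * cS)) / cS <= lambda)
    (lambda_lt : lambda < Num.sqrt (mD / cS)) :
  let M := riccati_flow A D Sigma in
  (* the solution from [P] exists on [0, +oo[ and stays in the domain of d_T *)
  (forall P, pos_op_upto lambda P ->
     riccati_solution A D Sigma `[0, +oo[ P (fun t => M t P) /\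
     forall t, 0 <= t -> pos_op (M t P)) /\
  exists2 alpha : R, (mD - cS * lambda ^+ 2) / lambda <= alpha &
    (forall P1 P2, pos_op_upto lambda P1 -> pos_op_upto lambda P2 ->
       forall t, 0 <= t ->
         thompson_dist (M t P1) (M t P2)
           <= expR (- (alpha * t)) * thompson_dist P1 P2) /\
    exists Pbar : E -> E,
      [/\ pos_op_upto lambda Pbar,
          riccati_rhs A D Sigma Pbar = 0,
          forall Q, pos_op_upto lambda Q -> riccati_rhs A D Sigma Q = 0 ->
            Q = Pbar
        & forall P, pos_op_upto lambda P -> forall t, 0 <= t ->
            thompson_dist (M t P) Pbar
              <= expR (- (alpha * t)) * thompson_dist P Pbar].
Proof.
move=> M; have [bA' adjA] := adjoint_exists bA hA.
have lambda_gt0 : 0 < lambda.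
  apply: lt_le_trans lambda_ge; rewrite divr_gt0 // subr_gt0 disc_sqrt_lt //.
  by rewrite mulr_gt0.
have lambda_sqr : cS * lambda ^+ 2 < mD.
  rewrite mulrC -ltr_pdivlMr // -(@sqr_sqrtr _ (mD / cS)); last first.
    by rewrite divr_ge0 // ltW.
  by rewrite ltrXn2r ?nnegrE // ?sqrtr_ge0 // ltW.
pose alpha := (mD - cS * lambda ^+ 2) / lambda.
have alpha_gt0 : 0 < alpha by rewrite divr_gt0 // subr_gt0.
have alphaE : alpha * lambda = mD - cS * lambda ^+ 2.
  by rewrite /alpha divfK // gt_eqF.
have fA x : 2 * ip (A x) x <= - (2 * cA) * ip x x.
  have := le_op_form x hA; rewrite ip_scalar_op !fctE ipDl.
  by rewrite [ip (adjoint A x) x]ipC -adjA; lra.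
have fmD x : mD * ip x x <= ip (D x) x by rewrite -ip_scalar_op le_op_form.
have fcD x : ip (D x) x <= cD * ip x x by rewrite -ip_scalar_op le_op_form.
have fS x : - cS * ip x x <= ip (Sigma x) x by rewrite -ip_scalar_op le_op_form.
have lambda_super x : ric_form A D Sigma (scalar_op lambda) x <= 0.
  rewrite ric_form_scalar //.
  have [->|/eqP x0] := eqVneq x 0; first by rewrite !ip0r; lra.
  have N0 : 0 < ip x x by rewrite -nr_sqr exprn_gt0 // nr_gt0.
  have mc : mD <= cD.
    by rewrite -(ler_pM2r N0); apply: le_trans (fmD x) (fcD x).
  have := between_roots cA_gt0 cD_gt0 cS_gt0 hdisc mc lambda_ge lambda_sqr.
  move=> /(ler_wpM2r (ltW N0)); rewrite mul0r.
  have := ler_wpM2l (ltW lambda_gt0) (fA x).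
  have := ler_wpM2l (sqr_ge0 lambda) (fS x).
  have := fcD x; lra.
have [d0 d0_gt0 d0_sub] : exists2 d0, 0 < d0 & forall d x, 0 <= d -> d <= d0 ->
    0 <= ric_form A D Sigma (scalar_op d) x.
  have /bounded_opP[_ [a a0 ha]] := bA; have [c c0 hc] := sym_bd sSigma.
  have ac0 : 0 < 2 * a + c + 1 by lra.
  exists (Num.min 1 (mD / (2 * a + c + 1))); first by rewrite lt_min ltr01 divr_gt0.
  move=> d x dg; rewrite le_min ler_pdivlMr // => /andP[d1 d2].
  rewrite ric_form_scalar //; have N0 := ip_ge0 x.
  have := nbd_ip_norm x ha; rewrite ler_norml => /andP[/(ler_wpM2l dg) q1 _].
  have := nbd_ip_norm x hc; rewrite ler_norml => /andP[_].
  move=> /(ler_wpM2l (sqr_ge0 d)) q2.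
  have dd : d ^+ 2 <= d by rewrite expr2 ler_piMr.
  have q3 := ler_wpM2r (mulr_ge0 c0 N0) dd.
  have q4 := ler_wpM2r N0 d2; have q5 := fmD x.
  have q6 : 0 <= d * ip x x by rewrite mulr_ge0.
  lra.
have contraction P1 P2 t (u1 : pos_op_upto lambda P1) (u2 : pos_op_upto lambda P2)
    (t0 : 0 <= t) : thompson_dist (M t P1) (M t P2)
      <= expR (- (alpha * t)) * thompson_dist P1 P2.
  exact: (flow_contraction bA bA' adjA sD sSigma lambda_gt0 mD_gt0 cS_gt0
    alpha_gt0 alphaE fmD fS lambda_super d0_gt0 d0_sub u1 u2 t0).
have [Pbar uPbar hPbar] := stationary_exists bA bA' adjA sD sSigma lambda_gt0 mD_gt0
  cS_gt0 alpha_gt0 alphaE fmD fS lambda_super d0_gt0 d0_sub.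
split.
  move=> P /(box_upto _ d0_gt0)[d [dg dd bP]]; split.
    exact: (flow_solution bA bA' adjA sD sSigma lambda_gt0 lambda_super d0_sub dg dd bP).
  move=> t t0.
  have bM := flow_box bA bA' adjA sD sSigma lambda_gt0 lambda_super d0_sub dg dd bP t0.
  have : pos_op_upto lambda (M t P) by apply/(box_upto _ d0_gt0); exists d.
  by case.
exists alpha => //; split=> [P1 P2 u1 u2 t t0|]; first exact: contraction.
exists Pbar; split=> // [Q uQ hQ|P uP t t0].
  exact: (stationary_unique bA bA' adjA sD sSigma lambda_gt0 mD_gt0 cS_gt0
    alpha_gt0 alphaE fmD fS lambda_super d0_gt0 d0_sub uQ uPbar hQ hPbar).
have sPbar := pos_sym uPbar.1.
have fixPbar : M t Pbar = Pbar.
  exact: (riccati_flowE bA bA' adjA sD sSigma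
    (stationary_solution _ sPbar hPbar) t0 (lexx t)).
by have := contraction _ _ t uP uPbar t0; rewrite fixPbar.
Qed.
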